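(* Let $D\subset\mathbb{C}^n$ be a bounded domain and let $(E,h)$ be a holomorphic vector bundle (of finite rank) over $D$ equipped with a singular Finsler metric $h$, such that the norm (with respect to the dual metric $h^*$) of any local holomorphic section of $E^*$ is upper semicontinuous. If $(E,h)$ has the multiple $L^p$-extension property for some $p>0$, then $(E,h)$ is positively curved in the sense of Griffiths, namely $\log|u|_{h^*}$ is plurisubharmonic for any local holomorphic section $u$ of $E^*$.
   Context: A (singular) Finsler metric $h$ on a holomorphic vector bundle $E$ is a function $h:E\to[0,+\infty]$ with $h(cv)=|c|^2h(v)$ for all $v\in E$, $c\in\mathbb{C}$; one writes $|v|_h^2=h(v)$ (or $|v|^2$). No regularity is assumed. Dual metric: for $f\in E^*_x$, $|f|_{h^*}:=0$ if $|v|_h=+\infty$ for all nonzero $v\in E_x$; otherwise $|f|_{h^*}:=\sup\{|f(v)|: v\in E_x,\ |v|_h\le1\}\in[0,+\infty]$. Metric on tensor powers: let $V=E_x$. Viewing $\xi\in V^{\otimes m}$ as a multilinear map $(V^* )^m\to\mathbb{C}$ (via $V=(V^* )^*$), its norm is $|\xi|:=\sup\{|\xi(u_1,\dots,u_m)|: u_i\in V^*,\ |u_i|_{h^*}\le1,\ 1\le i\le m\}$ if some nonzero $u\in V^*$ has $|u|_{h^*}<+\infty$, and $|\xi|:=0$ otherwise. (The norm on $(V^* )^{\otimes m}$ is defined in the same way using $V$ and $h$.) These induce norms on $E^{\otimes m}$ pointwise. Multiple $L^p$-extension property (for a fixed $p>0$): there are constants $C_m$ ($m\ge1$ an integer), independent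 of the point $z$ below, with $\frac1m\log C_m\to0$ as $m\to\infty$, such that for any $z\in D$, any nonzero $a\in E_z$ with finite norm $|a|=|a|_h$, and any $m\ge1$, there is a holomorphic section $f_m$ of $E^{\otimes m}$ on $D$ with $f_m(z)=a^{\otimes m}$ and $\int_D|f_m|^p\le C_m|a|^{mp}$ (Lebesgue measure on $D$, $|f_m|$ the norm on $E^{\otimes m}$ above). The function identically $-\infty$ is regarded as plurisubharmonic. *)

(* Defs.v *)
From HB Require Import structures.
From mathcomp Require Import all_boot all_order all_algebra.
From mathcomp Require Import all_classical all_reals all_analysis.
From mathcomp Require Import complex.

Set Implicit Arguments.
Unset Strict Implicit.
Unset Printing Implicit Defensive.

Import Order.TTheory GRing.Theory Num.Theory.
Import numFieldNormedType.Exports.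

Local Open Scope classical_set_scope.
Local Open Scope ring_scope.

(* As the library does for abstract numFieldTypes, R[i] inherits its topology
   from R[i]^o; the norm is the modulus, with values in R[i]. *)
#[non_forgetful_inheritance]
HB.instance Definition _ (R : realType) := GRing.ComAlgebra.copy R[i] R[i]^o.
#[non_forgetful_inheritance]
HB.instance Definition _ (R : realType) := Vector.copy R[i] R[i]^o.
#[non_forgetful_inheritance]
HB.instance Definition _ (R : realType) := NormedModule.copy R[i] R[i]^o.

(* The library has products of two measures only; this is the n-fold product,
   obtained by pushing mu \x mu^n forward along (x, t) |-> x :: t. *)
Section tuple_measure.
Local Open Scope ereal_scope.
Context {d : measure_display} {T : measurableType d} {R : realType}.
Variable mu : {sigma_finite_measure set T -> \bar R}.

Section tuple_measureS.
Context {n : nat}.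
Variable nu : {sigma_finite_measure set (n.-tuple T) -> \bar R}.

Let cons_pair (x : T * n.-tuple T) : n.+1.-tuple T := [tuple of x.1 :: x.2].

Let uncons (t : n.+1.-tuple T) : T * n.-tuple T :=
  (tnth t ord0, [tuple of behead t]).

Let measurable_cons_pair : measurable_fun [set: T * n.-tuple T] cons_pair.
Proof. exact: measurable_cons. Qed.

Let measurable_uncons : measurable_fun [set: n.+1.-tuple T] uncons.
Proof.
apply: measurable_fun_pair; first exact: measurable_tnth.
exact: measurable_behead.
Qed.

Definition tuple_measureS : set (n.+1.-tuple T) -> \bar R :=
  pushforward (mu \x nu) cons_pair.

Let tuple_measureS0 : tuple_measureS set0 = 0.
Proof. by rewrite /tuple_measureS /pushforward preimage_set0 measure0. Qed.

Let tuple_measureS_ge0 A : 0 <= tuple_measureS A.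
Proof. exact: measure_ge0. Qed.

Let tuple_measureS_sigma_additive : semi_sigma_additive tuple_measureS.
Proof.
exact: (@measure_semi_sigma_additive _ _ _
  (pushforward (mu \x nu) cons_pair)).
Qed.

HB.instance Definition _ := isMeasure.Build _ _ _ tuple_measureS
  tuple_measureS0 tuple_measureS_ge0 tuple_measureS_sigma_additive.

Let tuple_measureS_sigma_finite : sigma_finite setT tuple_measureS.
Proof.
have /sigma_finiteP[F [FT ndF Foo]] := sigma_finiteT mu.
have /sigma_finiteP[G [GT ndG Goo]] := sigma_finiteT nu.
exists (fun k => uncons @^-1` (F k `*` G k)).
  rewrite -preimage_bigcup; apply/esym/seteqP; split=> // t _ /=.
  have [i _ Fi] : (\bigcup_i F i) (uncons t).1 by rewrite -FT.
  have [j _ Gj] : (\bigcup_i G i) (uncons t).2 by rewrite -GT.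
  exists (maxn i j) => //; split.
  - by move: Fi; exact/subsetPset/ndF/leq_maxl.
  - by move: Gj; exact/subsetPset/ndG/leq_maxr.
move=> k; have [mFk Fk] := Foo k; have [mGk Gk] := Goo k; split.
  rewrite -[X in measurable X]setTI.
  by apply: measurable_uncons => //; exact: measurableX.
rewrite /tuple_measureS /pushforward -comp_preimage.
rewrite (_ : uncons \o cons_pair = id); last first.
  by apply/funext => -[x t]; congr (_, _); apply/val_inj.
by rewrite preimage_id product_measure1E// lte_mul_pinfty// ge0_fin_numE.
Qed.

HB.instance Definition _ := Measure_isSigmaFinite.Build _ _ _ tuple_measureS
  tuple_measureS_sigma_finite.

End tuple_measureS.

Fixpoint tuple_measure (n : nat) :
    {sigma_finite_measure set (n.-tuple T) -> \bar R} :=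
  match n with
  | 0 => \d_ ([tuple] : 0.-tuple T)
  | n'.+1 => tuple_measureS (tuple_measure n')
  end.

End tuple_measure.

(* A separate constant is needed: the sigma-finite instance of the library on
   \x is reserved for products of subprobabilities. *)
Section lebesgue_measure2.
Local Open Scope ereal_scope.
Context {R : realType}.

Definition lebesgue_measure2 :
    set (measurableTypeR R * measurableTypeR R) -> \bar R :=
  lebesgue_measure \x lebesgue_measure.

HB.instance Definition _ := Measure.copy lebesgue_measure2
  ((@lebesgue_measure R) \x (@lebesgue_measure R)).

Let lebesgue_measure2_sigma_finite : sigma_finite setT lebesgue_measure2.
Proof.
have /sigma_finiteP[F [FT ndF Foo]] := sigma_finiteT (@lebesgue_measure R).
exists (fun k => F k `*` F k).
  apply/esym/seteqP; split=> // -[x y] _ /=.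
  have [i _ Fi] : (\bigcup_i F i) x by rewrite -FT.
  have [j _ Fj] : (\bigcup_i F i) y by rewrite -FT.
  exists (maxn i j) => //; split.
  - by move: Fi; exact/subsetPset/ndF/leq_maxl.
  - by move: Fj; exact/subsetPset/ndF/leq_maxr.
move=> k; have [mFk Fk] := Foo k; split; first exact: measurableX.
rewrite /lebesgue_measure2 product_measure1E// lte_mul_pinfty//.
by rewrite ge0_fin_numE.
Qed.

HB.instance Definition _ := Measure_isSigmaFinite.Build _ _ _ lebesgue_measure2
  lebesgue_measure2_sigma_finite.

End lebesgue_measure2.

Section complex_analysis.
Context {R : realType} {n : nat}.
Local Notation C := R[i].
Implicit Types (D U : set 'rV[C]_n) (phi : 'rV[C]_n -> \bar R).

Definition is_domain D := [/\ open D, connected D & D !=set0].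

(* Differentials are linear over R[i] here: this is complex
   differentiability. *)
Definition holomorphic_on U (g : 'rV[C]_n -> C) :=
  forall z, U z -> differentiable g z.

(* cf. lower_semicontinuous; the value +oo is not excluded *)
Definition usc_on U phi :=
  forall z, U z -> forall a : R, (phi z < a%:E)%E ->
  exists2 V, nbhs z V & forall w, V w -> U w -> (phi w < a%:E)%E.

Definition circle_mean phi (z w : 'rV[C]_n) : \bar R :=
  ((2 * pi)^-1%:E *
   \int[lebesgue_measure]_(t in `[0%R, (2 * pi)%R])
     phi (z + (cos t +i* sin t)%C *: w)%R)%E.

Definition plurisubharmonic_on U phi :=
  [/\ forall z, U z -> (phi z < +oo)%E,
      usc_on U phi &
      forall z w, (forall c : C, `|c| <= 1 -> U (z + c *: w)) ->
        (phi z <= circle_mean phi z w)%E].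

Definition Cn_of_tuple (t : n.-tuple (measurableTypeR R * measurableTypeR R)) :
    'rV[C]_n :=
  \row_j ((tnth t j).1 +i* (tnth t j).2)%C.

Definition lebesgue_integral_Cn D phi : \bar R :=
  (\int[tuple_measure lebesgue_measure2 n]_(t in Cn_of_tuple @^-1` D)
     phi (Cn_of_tuple t))%E.

End complex_analysis.

Section fiberwise.
Context {R : realType}.
Local Notation C := R[i].
Local Notation dual V := 'Hom(V, C).
Implicit Type V : vectType C.

Definition modulus (c : C) : R := ComplexField.Normc.normc c.

(* |v|_h, from the metric h = |.|_h^2 *)
Definition norm_of V (h : V -> \bar R) (v : V) : \bar R :=
  sqrte (h v).

Definition dual_norm V (h : V -> \bar R) (f : dual V) : \bar R :=
  if `[< forall v, v != 0 -> norm_of h v = +oo%E >] then 0%E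
  else ereal_sup [set (modulus (f v))%:E | v in
                   [set v | (norm_of h v <= 1)%E]].

Definition multilinear_map m (W : lmodType C) (xi : ('I_m -> W) -> C) :=
  forall (i : 'I_m) (u : 'I_m -> W) (c : C) (w w' : W),
    xi (dfwith u i (c *: w + w')) = c * xi (dfwith u i w) + xi (dfwith u i w').

(* the m-th tensor power of V, as multilinear maps on (V^* )^m *)
Record tensor m V := Tensor {
  tensor_fun :> ('I_m -> dual V) -> C;
  tensor_multilinear : multilinear_map tensor_fun }.

Definition tensor_norm m V (h : V -> \bar R) (xi : tensor m V) : \bar R :=
  if `[< exists2 f : dual V, f != 0 & (dual_norm h f < +oo)%E >] then
    ereal_sup [set (modulus (xi u))%:E | u in
                [set u : 'I_m -> dual V |
                  forall i, (dual_norm h (u i) <= 1)%E]]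
  else 0%E.

Lemma tensor_power_subproof m V (a : V) :
  multilinear_map (fun u : 'I_m -> dual V => \prod_(i < m) u i a).
Proof.
move=> i u c w w'.
have E f : \prod_(j < m) dfwith u i f j a = f a * \prod_(j < m | j != i) u j a.
  rewrite (bigD1 i)// dfwithin; congr (_ * _).
  by apply: eq_bigr => j ji; rewrite dfwithout// eq_sym.
by rewrite !E add_lfunE scale_lfunE mulrDl mulrA.
Qed.

Definition tensor_power m V (a : V) : tensor m V :=
  Tensor (@tensor_power_subproof m V a).

End fiberwise.

(* A holomorphic vector bundle of rank r over D, given by its fibres and by
   local frames, any two of which are related by a holomorphic matrix.  Only
   the fibres over D are meaningful. *)
Record hol_bundle (R : realType) (n : nat) (D : set 'rV[R[i]]_n) (r : nat) :=
  HolBundle {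
    fiber : 'rV[R[i]]_n -> vectType R[i];
    frame_index : Type;
    frame_dom : frame_index -> set 'rV[R[i]]_n;
    frame : frame_index -> forall z, r.-tuple (fiber z);
    frame_dom_open : forall i, open (frame_dom i);
    frame_dom_cover : D = \bigcup_i frame_dom i;
    frame_basis : forall i z, frame_dom i z -> basis_of fullv (frame i z);
    frame_transition : forall i j (k l : 'I_r),
      holomorphic_on (frame_dom i `&` frame_dom j)
        (fun z => coord (frame j z) l (tnth (frame i z) k)) }.

Section bundles.
Context {R : realType} {n : nat} {D : set 'rV[R[i]]_n} {r : nat}.
Local Notation C := R[i].
Variable E : hol_bundle D r.
Local Notation metric := (forall z, fiber E z -> \bar R).
Implicit Type h : metric.

(* 0 * +oo = 0 in \bar R, so that h z 0 = 0. *)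
Definition singular_finsler_metric h :=
  forall z, D z -> forall v,
    (0 <= h z v)%E /\
    forall c : C, h z (c *: v) = ((modulus c ^+ 2)%:E * h z v)%E.

(* sections of E^* over U, and sections of the m-th tensor power of E over D,
   are holomorphic when their components in the local frames of E are *)
Definition holomorphic_dual_section (U : set 'rV[C]_n)
    (u : forall z, 'Hom(fiber E z, C)) :=
  forall (i : frame_index E) (k : 'I_r),
    holomorphic_on (U `&` frame_dom i) (fun z => u z (tnth (frame i z) k)).

Definition holomorphic_tensor_section (m : nat)
    (f : forall z, tensor m (fiber E z)) :=
  forall (i : frame_index E) (k : 'I_m -> 'I_r),
    holomorphic_on (frame_dom i)
      (fun z => f z (fun j => linfun (coord (frame i z) (k j)))).

Definition dual_norms_usc h :=
  forall U u, open U -> U `<=` D -> holomorphic_dual_section U u ->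
    usc_on U (fun z => dual_norm (h z) (u z)).

Definition multiple_Lp_extension h (p : R) :=
  exists c : nat -> R,
    [/\ forall m, (0 < m)%N -> 0 < c m,
        (fun m => m%:R^-1 * ln (c m)) @ \oo --> (0 : R) &
        forall z (a : fiber E z) (m : nat),
          D z -> a != 0 -> (norm_of (h z) a < +oo)%E -> (0 < m)%N ->
          exists f : forall w, tensor m (fiber E w),
            [/\ holomorphic_tensor_section f,
                f z = tensor_power m a &
                (lebesgue_integral_Cn D
                   (fun w => poweR (tensor_norm (h w) (f w)) p) <=
                 (c m)%:E * poweR (norm_of (h z) a) (m%:R * p))%E]].

Definition griffiths_positive h :=
  forall U u, open U -> U `<=` D -> holomorphic_dual_section U u ->
    plurisubharmonic_on U (fun z => lne (dual_norm (h z) (u z))).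

End bundles.

(* Main.v *)
Require Import Defs.
From mathcomp Require Import all_boot all_order all_algebra.
From mathcomp Require Import all_classical all_reals all_analysis.
From mathcomp Require Import measurable_realfun complex.
From mathcomp Require Import ring lra.

(** Let the disc [z + c *: w], [|c| <= 1], lie in [U], and let [Psi] be a
    Lipschitz function with [log |u| <= Psi] near the bounding circle. The heart
    of the proof is [dual_norm_circle]: [log |u|] at [z] is then at most the mean
    of [Psi] over the circle. To see this, let [a] be a vector of norm at most 1
    at [z], and extend its [m]-th tensor power to a section [f] of [E^m] whose
    norm has its [L^p] size bounded by [C_m]. The function [g = <f, u^m>] is
    holomorphic, takes the value [u(a)^m] at [z], and satisfies
    [|g| <= |f| |u|^m <= |f| exp (m Psi)] near the circle. A holomorphic [g]
    satisfies the weighted submean inequality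
      [|g(z)|^p exp (- p mean (m Psi)) <= mean (|g|^p exp (- p m Psi))]
    over circles. Averaged over the nearby discs with the same centre and
    direction [w + y], [y] small, its right-hand side is at most a constant times
    the integral of [|f|^p], hence a constant times [C_m]
    ([thin_tube_integral]). Taking [m]-th roots and letting [m] tend to infinity
    gives [log |u(a)| <= mean Psi], up to an error that vanishes with the
    radius of the tube, and it remains to take the supremum over [a].

    The submean inequality [weighted_submean] is [log |G(0)| <= mean (log |G|)]
    together with the convexity of the exponential. To stay away from the
    zeros of [G], it is obtained from the maximum principle, applied to the
    product of the [N] rotations of [G] by [N]-th roots of unity, and from the
    inequality between arithmetic and geometric means; Riemann sums become
    integrals as [N] grows. The maximum principle itself follows from the
    independence of the circular means of [G] from the radius. In logarithmic
    polar coordinates this is the vanishing of an integral along the boundary of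
    a rectangle, by Goursat's bisection ([goursat_rectangle]), which assumes
    only pointwise differentiability.

    It remains to replace [Psi] by [log |u|], which is only upper
    semicontinuous. It is first shown not to take the value [+oo], by the
    inequality above applied with a constant [Psi]
    ([dual_norm_lty]). It is then bounded above near the closed disc, hence the
    decreasing limit of Lipschitz functions, and monotone convergence applies
    ([usc_circle_mean]).

    No measurability of the norm of [f] is known. Its integral is the supremum
    of the integrals of the simple functions below it, which makes it monotone
    ([ge0_le_integral_nonmeasurable]), and the function to which Fubini's
    theorem is applied is the weight [|g|^p exp (- p m Psi)], continuous on the
    tube. *)

Set Implicit Arguments.
Unset Strict Implicit.
Unset Printing Implicit Defensive.

Import Order.TTheory GRing.Theory Num.Theory.
Import numFieldNormedType.Exports.

Local Open Scope classical_set_scope.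
Local Open Scope ring_scope.

(** * Goursat's theorem on rectangles *)

Section rectangles.
Context {R : realType}.
Implicit Types (f g : R -> R) (P Q : R -> R -> R) (a b c d x e : R).
Local Notation mu := (@lebesgue_measure R).

Lemma continuous_withinP f a b :
  (forall x, x \in `[a, b] -> forall e : R, 0 < e -> exists2 d : R, 0 < d &
    forall y, y \in `[a, b] -> `|y - x| < d -> `|f y - f x| <= e) ->
  {within `[a, b], continuous f}.
Proof.
move=> H; apply/subspace_continuousP => x abx.
apply/cvgrPdist_le => e e0; have [d d0 Hd] := H x abx e e0.
rewrite near_withinE; apply/nbhs_ballP; exists d => //= y.
by rewrite /ball/= distrC => xyd aby; rewrite distrC; exact: Hd.
Qed.

Lemma within_continuousB f g a b : {within `[a, b], continuous f} ->
  {within `[a, b], continuous g} -> {within `[a, b], continuous (fun x => f x - g x)}.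
Proof.
move=> /subspace_continuousP cf /subspace_continuousP cg.
apply/subspace_continuousP => x abx.
by apply: cvgB; [exact: cf|exact: cg].
Qed.

Lemma integrable_itv f a b : {within `[a, b], continuous f} ->
  mu.-integrable `[a, b] (EFin \o f).
Proof.
by move=> cf; apply: continuous_compact_integrable => //; exact: segment_compact.
Qed.

Definition segint f a b : R := \int[mu]_(x in `[a, b]) f x.

Lemma segint_cst (k : R) a b : a <= b -> segint (fun=> k) a b = k * (b - a).
Proof.
move=> ab; rewrite /segint Rintegral_cst//=.
rewrite [X in fine X](_ : _ = (b - a)%:E)//.
have := @lebesgue_measure_itv R `[a, b]; rewrite /= => ->; rewrite lte_fin.
by case: ltgtP ab => // ->; rewrite subrr.
Qed.

Lemma segintB f g a b : {within `[a, b], continuous f} ->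
  {within `[a, b], continuous g} ->
  segint (fun x => f x - g x) a b = segint f a b - segint g a b.
Proof. by move=> cf cg; apply: RintegralB => //; exact: integrable_itv. Qed.

Lemma segintZ f (k a b : R) : {within `[a, b], continuous f} ->
  segint (fun x => k * f x) a b = k * segint f a b.
Proof. by move=> cf; apply: RintegralZl => //; exact: integrable_itv. Qed.

Lemma segint_split f a b c : a <= c <= b -> {within `[a, b], continuous f} ->
  segint f a b = segint f a c + segint f c b.
Proof.
move=> /andP[ac cb] cf; rewrite /segint; apply/eqP.
have ifab := integrable_itv cf.
rewrite addrC -subr_eq Rintegral_itvB// ?bnd_simp//.
rewrite Rintegral_itv_obnd_cbnd//; apply: integrableS ifab => //.
by apply: subset_itv; rewrite bnd_simp.
Qed.

Lemma segint_bound f a b (k : R) : a <= b -> {within `[a, b], continuous f} ->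
  (forall x, x \in `[a, b] -> `|f x| <= k) -> `|segint f a b| <= k * (b - a).
Proof.
move=> ab cf fk; apply: le_trans (le_normr_Rintegral _ _) _ => //.
  exact: integrable_itv.
rewrite -segint_cst//; apply: le_Rintegral => //.
- exact/integrable_norm/integrable_itv.
- by apply: integrable_itv => x; exact: cst_continuous.
Qed.

(** Pointwise differentiability of the pair (P, Q), with the one first-order
    relation that closes the form [Q dx + P dy]; no continuity of the
    derivatives. *)
Definition cr_on a b c d P Q :=
  forall x y, x \in `[a, b] -> y \in `[c, d] -> exists p p' q' : R,
  forall e : R, 0 < e -> exists2 h : R, 0 < h &
  forall u v, u \in `[a, b] -> v \in `[c, d] -> `|u - x| < h -> `|v - y| < h ->
    `|P u v - P x y - (p * (u - x) + p' * (v - y))| <= e * (`|u - x| + `|v - y|)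
    /\
    `|Q u v - Q x y - (q' * (u - x) + p * (v - y))| <= e * (`|u - x| + `|v - y|).

(** The integral of [Q dx + P dy] along the boundary of a rectangle. *)
Definition boundint P Q a b c d :=
  segint (fun x => Q x c - Q x d) a b + segint (fun y => P b y - P a y) c d.

Section on_rectangle.
Variables (a b c d : R) (P Q : R -> R -> R).
Hypothesis cr : cr_on a b c d P Q.

Lemma cr_contx y (F := fun F => F = P \/ F = Q) G : F G -> y \in `[c, d] ->
  {within `[a, b], continuous (G ^~ y)}.
Proof.
move=> FG cdy; apply: continuous_withinP => x abx e e0.
have [p [p' [q' H]]] := cr abx cdy.
have [h h0 {}H] := H 1 ltr01.
pose K := 1 + `|p| + `|q'|.
have K0 : 0 < K by rewrite /K -addrA ltr_wpDr// addr_ge0.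
exists (Num.min h (e / K)); first by rewrite lt_min h0 divr_gt0.
move=> u abu; rewrite lt_min ltr_pdivlMr// => /andP[uh ue].
have [] := H u y abu cdy uh; first by rewrite subrr normr0.
rewrite subrr !mulr0 !addr0 normr0 addr0 mul1r => HP HQ.
apply: le_trans (ltW ue); rewrite /K.
have [->|->] := FG.
  rewrite -[P u y - P x y](subrK (p * (u - x))).
  rewrite (le_trans (ler_normD _ _))// normrM.
  by have := normr_ge0 (u - x); have := normr_ge0 q'; nra.
rewrite -[Q u y - Q x y](subrK (q' * (u - x))).
rewrite (le_trans (ler_normD _ _))// normrM.
by have := normr_ge0 (u - x); have := normr_ge0 p; nra.
Qed.

Lemma cr_conty x (F := fun F => F = P \/ F = Q) G : F G -> x \in `[a, b] ->
  {within `[c, d], continuous (G x)}.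
Proof.
move=> FG abx; apply: continuous_withinP => y cdy e e0.
have [p [p' [q' H]]] := cr abx cdy.
have [h h0 {}H] := H 1 ltr01.
pose K := 1 + `|p| + `|p'|.
have K0 : 0 < K by rewrite /K -addrA ltr_wpDr// addr_ge0.
exists (Num.min h (e / K)); first by rewrite lt_min h0 divr_gt0.
move=> v cdv; rewrite lt_min ltr_pdivlMr// => /andP[vh ve].
have [] := H x v abx cdv _ vh; first by rewrite subrr normr0.
rewrite subrr !mulr0 !add0r normr0 add0r mul1r => HP HQ.
apply: le_trans (ltW ve); rewrite /K.
have [->|->] := FG.
  rewrite -[P x v - P x y](subrK (p' * (v - y))).
  rewrite (le_trans (ler_normD _ _))// normrM.
  by have := normr_ge0 (v - y); have := normr_ge0 p; nra.
rewrite -[Q x v - Q x y](subrK (p * (v - y))).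
rewrite (le_trans (ler_normD _ _))// normrM.
by have := normr_ge0 (v - y); have := normr_ge0 p'; nra.
Qed.

End on_rectangle.

Lemma cr_onS a b c d a' b' c' d' P Q : cr_on a b c d P Q ->
  a <= a' -> b' <= b -> c <= c' -> d' <= d -> cr_on a' b' c' d' P Q.
Proof.
move=> H aa bb cc dd x y abx cdy.
have S1 u : u \in `[a', b'] -> u \in `[a, b] by apply: subset_itv; rewrite bnd_simp.
have S2 u : u \in `[c', d'] -> u \in `[c, d] by apply: subset_itv; rewrite bnd_simp.
have [p [p' [q' K]]] := H x y (S1 _ abx) (S2 _ cdy).
exists p, p', q' => e e0; have [h h0 {}K] := K e e0.
by exists h => // u v /S1 ? /S2 ?; exact: K.
Qed.

Lemma boundint_split P Q a b c d m n : cr_on a b c d P Q ->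
  a <= m <= b -> c <= n <= d ->
  boundint P Q a b c d = boundint P Q a m c n + boundint P Q m b c n +
    boundint P Q a m n d + boundint P Q m b n d.
Proof.
move=> cr amb cnd.
have /andP[am mb] := amb; have /andP[cn nd] := cnd.
have ab := le_trans am mb; have cd := le_trans cn nd.
have cPx y := @cr_contx _ _ _ _ _ _ cr y _ (or_introl erefl).
have cQx y := @cr_contx _ _ _ _ _ _ cr y _ (or_intror erefl).
have cPy y := @cr_conty _ _ _ _ _ _ cr y _ (or_introl erefl).
have cQy y := @cr_conty _ _ _ _ _ _ cr y _ (or_intror erefl).
have i1 : c \in `[c, d] by rewrite in_itv/= lexx.
have i2 : d \in `[c, d] by rewrite in_itv/= lexx andbT.
have i3 : n \in `[c, d] by rewrite in_itv/= cn.
have j1 : a \in `[a, b] by rewrite in_itv/= lexx.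
have j2 : b \in `[a, b] by rewrite in_itv/= lexx andbT.
have j3 : m \in `[a, b] by rewrite in_itv/= am.
have S f x y x' y' : {within `[x, y], continuous f} -> x <= x' -> y' <= y ->
    {within `[x', y'], continuous f}.
  move=> cf xx yy; apply: continuous_subspaceW cf.
  by apply: subset_itv; rewrite bnd_simp.
rewrite /boundint !segintB; try by [apply: S; [|
  rewrite ?lexx|rewrite ?lexx]; eauto].
all: try by eauto.
all: try by [apply: (S _ a b); eauto| apply: (S _ c d); eauto].
rewrite (segint_split amb (cQx _ i1)) (segint_split amb (cQx _ i2)).
rewrite (segint_split cnd (cPy _ j1)) (segint_split cnd (cPy _ j2)).
ring.
Qed.

End rectangles.

Section goursat.
Context {R : realType}.
Implicit Types (P Q : R -> R -> R) (a b c d x e : R).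

(** The common point is the supremum of the left end points. *)
Lemma nested_itv (s : nat -> R) (L : R) :
  (forall k, s k <= s k.+1 <= s k + L / 2 ^+ k.+1) ->
  exists x, forall k, s k <= x <= s k + L / 2 ^+ k.
Proof.
move=> H.
have half k : L / 2 ^+ k = L / 2 ^+ k.+1 + L / 2 ^+ k.+1.
  by rewrite exprS invfM; field; rewrite expf_neq0//= pnatr_eq0.
have up k : s k.+1 + L / 2 ^+ k.+1 <= s k + L / 2 ^+ k.
  by have /andP[_ h] := H k; have := half k; lra.
have mono k l : s k <= s (k + l)%N /\
    s (k + l)%N + L / 2 ^+ (k + l) <= s k + L / 2 ^+ k.
  elim: l => [|l [h1 h2]]; first by rewrite addn0.
  rewrite addnS; split; first by have /andP[h _] := H (k + l)%N; exact: le_trans h1 h.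
  by apply: le_trans h2; exact: up.
have L0 k : 0 <= L / 2 ^+ k.
  suff : 0 <= L by move=> L0; rewrite divr_ge0// exprn_ge0.
  by have /andP[h1 h2] := H 0%N; have := le_trans h1 h2; rewrite lerDl pmulr_lge0// invr_gt0 exprn_gt0.
have ubs k : ubound (range s) (s k + L / 2 ^+ k).
  move=> _ [j _ <-]; have [h|h] := leqP j k.
    have [h1 _] := mono j (k - j)%N; rewrite subnKC// in h1.
    by rewrite (le_trans h1)// lerDl.
  have [_ h2] := mono k (j - k)%N; rewrite subnKC ?(ltnW h)// in h2.
  by apply: le_trans h2; rewrite lerDl.
exists (sup (range s)) => k; apply/andP; split.
  apply: ub_le_sup; last by exists k.
  by exists (s 0%N + L / 2 ^+ 0); exact: ubs.
apply: sup_le_ub; last exact: ubs.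
by exists (s 0%N), 0%N.
Qed.

(** Bisection: a quarter of the rectangle carries at least a quarter of the
    integral, while differentiability at the point common to the chosen
    quarters makes the integral there small compared with the area. *)
Lemma goursat_rectangle a b c d P Q : a <= b -> c <= d -> cr_on a b c d P Q ->
  boundint P Q a b c d = 0.
Proof.
move=> ab cd cr; apply/eqP; rewrite -normr_le0 leNgt; apply/negP => j0.
set j := `|_| in j0.
pose L : R := b - a; pose H : R := d - c.
have L0 : 0 <= L by rewrite subr_ge0.
have H0 : 0 <= H by rewrite subr_ge0.
pose l k : R := L / 2 ^+ k; pose m k : R := H / 2 ^+ k.
have half (X : R) k : X / 2 ^+ k = X / 2 ^+ k.+1 + X / 2 ^+ k.+1.
  by rewrite exprS invfM; field; rewrite expf_neq0//= pnatr_eq0.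
have l0 k : 0 <= l k by rewrite divr_ge0// exprn_ge0.
have m0 k : 0 <= m k by rewrite divr_ge0// exprn_ge0.
pose bad k (q : R * R) := [/\ a <= q.1, q.1 + l k <= b, c <= q.2, q.2 + m k <= d &
  j / 4 ^+ k <= `|boundint P Q q.1 (q.1 + l k) q.2 (q.2 + m k)|].
have step (x : nat * (R * R)) : exists q', bad x.1 x.2 ->
    [/\ bad x.1.+1 q', x.2.1 <= q'.1 <= x.2.1 + l x.1.+1 &
        x.2.2 <= q'.2 <= x.2.2 + m x.1.+1].
  case: x => k [s t] /=; have [|nb] := pselect (bad k (s, t)); last by exists (s, t).
  move=> [/= as_ sb ct td jb].
  have lk : l k = l k.+1 + l k.+1 by exact: half.
  have mk : m k = m k.+1 + m k.+1 by exact: half.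
  have j4 : j / 4 ^+ k = 4 * (j / 4 ^+ k.+1).
    by rewrite exprS invfM; field; rewrite expf_neq0//= pnatr_eq0.
  have lk0 := l0 k.+1; have mk0 := m0 k.+1.
  have cr' : cr_on s (s + l k) t (t + m k) P Q by exact: cr_onS cr _ _ _ _.
  have e1 : s + l k.+1 + l k.+1 = s + l k by rewrite lk addrA.
  have e2 : t + m k.+1 + m k.+1 = t + m k by rewrite mk addrA.
  have b1 : s + l k.+1 <= b by rewrite (le_trans _ sb)// -e1 lerDl.
  have d1 : t + m k.+1 <= d by rewrite (le_trans _ td)// -e2 lerDl.
  have a1 : a <= s + l k.+1 by rewrite (le_trans as_)// lerDl.
  have c1 : c <= t + m k.+1 by rewrite (le_trans ct)// lerDl.
  have := @boundint_split R P Q s (s + l k) t (t + m k) (s + l k.+1) (t + m k.+1) cr'.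
  rewrite !lerDl lk mk !lerD2l !lerDl lk0 mk0/= => /(_ isT isT).
  rewrite -lk -mk => E; rewrite E in jb.
  have [hh|h1] := leP (j / 4 ^+ k.+1) `|boundint P Q s (s + l k.+1) t (t + m k.+1)|.
    by exists (s, t) => _; split; rewrite /bad /= ?e1 ?e2 ?lexx ?lerDl ?lk0 ?mk0.
  have [hh|h2] := leP (j / 4 ^+ k.+1) `|boundint P Q (s + l k.+1) (s + l k) t (t + m k.+1)|.
    by exists (s + l k.+1, t) => _; split; rewrite /bad /= ?e1 ?e2 ?lexx ?lerDl ?lk0 ?mk0.
  have [hh|h3] := leP (j / 4 ^+ k.+1) `|boundint P Q s (s + l k.+1) (t + m k.+1) (t + m k)|.
    by exists (s, t + m k.+1) => _; split; rewrite /bad /= ?e1 ?e2 ?lexx ?lerDl ?lk0 ?mk0.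
  have [hh|h4] := leP (j / 4 ^+ k.+1) `|boundint P Q (s + l k.+1) (s + l k) (t + m k.+1) (t + m k)|.
    by exists (s + l k.+1, t + m k.+1) => _; split; rewrite /bad /= ?e1 ?e2 ?lexx ?lerDl ?lk0 ?mk0.
  exfalso; move: jb; apply/negP; rewrite -ltNge j4.
  move: h1 h2 h3 h4; set A := boundint _ _ _ _ _ _; set B := boundint _ _ _ _ _ _.
  set C := boundint _ _ _ _ _ _; set D := boundint _ _ _ _ _ _.
  have := ler_normD (A + B + C) D; have := ler_normD (A + B) C.
  by have := ler_normD A B; clear; lra.
(* [q k] is the lower left corner of the quarter chosen at stage [k] *)
have [F HF] := choice step.
pose q := fix q k := if k is k'.+1 then F (k', q k') else (a, c).
have l00 : a + l 0%N = b by rewrite /l expr0 divr1 /L; ring.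
have m00 : c + m 0%N = d by rewrite /m expr0 divr1 /H; ring.
have badq k : bad k (q k).
  elim: k => [|k IH]; last by have [] := HF (k, q k) IH.
  by rewrite /bad /= l00 m00 expr0 divr1; split=> //; rewrite /j.
have [x Hx] := @nested_itv (fun k => (q k).1) L (fun k => let: And3 _ h _ := HF (k, q k) (badq k) in h).
have [y Hy] := @nested_itv (fun k => (q k).2) H (fun k => let: And3 _ _ h := HF (k, q k) (badq k) in h).
have abx : x \in `[a, b].
  by have := Hx 0%N; rewrite -/(l 0%N) [q 0%N]/= l00 in_itv/=.
have cdy : y \in `[c, d].
  by have := Hy 0%N; rewrite -/(m 0%N) [q 0%N]/= m00 in_itv/=.
have [p [p' [q' K]]] := cr _ _ abx cdy.
(* this tolerance makes the bound [2 e (l k + m k)^2] found below smaller than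
   [j / 4 ^ k] *)
pose e : R := j / (3 * ((L + H) ^+ 2 + 1)).
have LH0 : 0 <= (L + H) ^+ 2 by exact: sqr_ge0.
have e0 : 0 < e by rewrite divr_gt0// mulr_gt0// ltr_wpDl.
have [r r0 {}K] := K e e0.
have [k hk] : exists k, (L + H) / 2 ^+ k < r.
  have LHr : 0 <= (L + H) / r by apply: divr_ge0; [exact: addr_ge0|exact: ltW].
  have := archi_boundP LHr; set N := Num.bound _ => LN.
  have N2 : (N%:R : R) <= 2 ^+ N by rewrite -natrX ler_nat ltnW// ltn_expl.
  exists N; rewrite ltr_pdivrMr ?exprn_gt0//.
  rewrite ltr_pdivrMr// in LN; rewrite (lt_le_trans LN)// mulrC ler_pM2l//.
have [/= as_ sb ct td] := badq k; apply/negP; rewrite -ltNge.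
have /andP[sx xs] := Hx k; have /andP[ty yt] := Hy k.
move: as_ sb ct td sx xs ty yt; rewrite -/(l k) -/(m k).
move: (q k).1 (q k).2 => s t as_ sb ct td sx xs ty yt.
have lm : l k + m k < r by rewrite /l /m -mulrDl.
have cr' : cr_on s (s + l k) t (t + m k) P Q by exact: cr_onS cr _ _ _ _.
have cPx v := @cr_contx _ _ _ _ _ _ _ cr' v _ (or_introl erefl).
have cQx v := @cr_contx _ _ _ _ _ _ _ cr' v _ (or_intror erefl).
have cPy v := @cr_conty _ _ _ _ _ _ _ cr' v _ (or_introl erefl).
have cQy v := @cr_conty _ _ _ _ _ _ _ cr' v _ (or_intror erefl).
have lk0 := l0 k; have mk0 := m0 k.
have t1 : t \in `[t, t + m k] by rewrite in_itv/= lexx lerDl.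
have t2 : t + m k \in `[t, t + m k] by rewrite in_itv/= lexx lerDl mk0.
have s1 : s \in `[s, s + l k] by rewrite in_itv/= lexx lerDl.
have s2 : s + l k \in `[s, s + l k] by rewrite in_itv/= lexx lerDl lk0.
have KK u v : u \in `[s, s + l k] -> v \in `[t, t + m k] ->
    `|P u v - P x y - (p * (u - x) + p' * (v - y))| <= e * (l k + m k) /\
    `|Q u v - Q x y - (q' * (u - x) + p * (v - y))| <= e * (l k + m k).
  rewrite !in_itv/= => /andP[u1 u2] /andP[v1 v2].
  have ux : `|u - x| <= l k by rewrite ler_norml; move: sx xs u1 u2; clear; lra.
  have vy : `|v - y| <= m k by rewrite ler_norml; move: ty yt v1 v2; clear; lra.
  have uab : u \in `[a, b] by rewrite in_itv/= (le_trans as_) ?(le_trans u2).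
  have vcd : v \in `[c, d] by rewrite in_itv/= (le_trans ct) ?(le_trans v2).
  have [||A B] := K u v uab vcd.
  - by rewrite (le_lt_trans ux)// (le_lt_trans _ lm)// lerDl.
  - by rewrite (le_lt_trans vy)// (le_lt_trans _ lm)// lerDr.
  by split; [apply: le_trans A _|apply: le_trans B _];
    rewrite ler_pM2l// lerD.
have cst_c z a1 b1 : {within `[a1, b1], continuous (fun=> z : R)}.
  by move=> ?; exact: cst_continuous.
have ssl : s <= s + l k by rewrite lerDl.
have ttm : t <= t + m k by rewrite lerDl.
have I1 : `|segint (fun u => Q u t - Q u (t + m k)) s (s + l k) + p * m k * l k|
    <= 2 * e * (l k + m k) * l k.
  have -> : p * m k * l k = - segint (fun=> - (p * m k)) s (s + l k).
    by rewrite segint_cst//; ring.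
  have cf : {within `[s, s + l k], continuous (fun u => Q u t - Q u (t + m k))}.
    by apply: within_continuousB; [exact: cQx|exact: cQx].
  rewrite -segintB//.
  have -> : 2 * e * (l k + m k) * l k = 2 * e * (l k + m k) * (s + l k - s) by ring.
  apply: segint_bound => //.
    by apply: within_continuousB; [exact: cf|exact: cst_c].
  move=> u us; have [_ A] := KK u t us t1; have [_ B] := KK u (t + m k) us t2.
  have -> : Q u t - Q u (t + m k) - - (p * m k) =
     (Q u t - Q x y - (q' * (u - x) + p * (t - y))) -
     (Q u (t + m k) - Q x y - (q' * (u - x) + p * (t + m k - y))) by ring.
  by rewrite (le_trans (ler_normB _ _))//; move: A B; clear; lra.
have I2 : `|segint (fun v => P (s + l k) v - P s v) t (t + m k) - p * m k * l k|
    <= 2 * e * (l k + m k) * m k.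
  have -> : p * m k * l k = segint (fun=> (p * l k)) t (t + m k).
    by rewrite segint_cst//; ring.
  have cf : {within `[t, t + m k], continuous (fun v => P (s + l k) v - P s v)}.
    by apply: within_continuousB; [exact: cPy|exact: cPy].
  rewrite -segintB//.
  have -> : 2 * e * (l k + m k) * m k = 2 * e * (l k + m k) * (t + m k - t) by ring.
  apply: segint_bound => //.
    by apply: within_continuousB; [exact: cf|exact: cst_c].
  move=> u us; have [A _] := KK s u s1 us; have [B _] := KK (s + l k) u s2 us.
  have -> : P (s + l k) u - P s u - (p * l k) =
     (P (s + l k) u - P x y - (p * (s + l k - x) + p' * (u - y))) -
     (P s u - P x y - (p * (s - x) + p' * (u - y))) by ring.
  by rewrite (le_trans (ler_normB _ _))//; move: A B; clear; lra.
rewrite /boundint.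
set X := segint _ _ _ in I1 *; set Y := segint _ _ _ in I2 *.
have -> : X + Y = (X + p * m k * l k) + (Y - p * m k * l k) by ring.
apply: le_lt_trans (ler_normD _ _) _; apply: le_lt_trans (lerD I1 I2) _.
have -> : 2 * e * (l k + m k) * l k + 2 * e * (l k + m k) * m k =
    2 * e * (l k + m k) ^+ 2 by ring.
rewrite /l /m -mulrDl expr_div_n -exprM mulnC exprM.
have -> : 2 ^+ 2 = 4 :> R by ring.
rewrite mulrA ltr_pM2r ?invr_gt0 ?exprn_gt0//.
have w0 : 3 * ((L + H) ^+ 2 + 1) != 0 by rewrite mulf_neq0// gt_eqF// ltr_wpDl.
have ej : j = e * (3 * ((L + H) ^+ 2 + 1)) by rewrite /e divfK.
rewrite [ltRHS]ej [2 * e]mulrC -mulrA ltr_pM2l//.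
by move: LH0; clear; lra.
Qed.

End goursat.

(** * The complex exponential and the Cauchy-Riemann equations *)

Section complex_plane.
Context {R : realType}.
Local Notation C := R[i].
Implicit Types (a c z w : C) (x y s t e : R).

Lemma modulus0 : modulus (0 : C) = 0. Proof. exact: ComplexField.Normc.normc0. Qed.

Lemma modulus_eq0 z : modulus z = 0 -> z = 0.
Proof. exact: ComplexField.Normc.eq0_normc. Qed.

Lemma modulusM z w : modulus (z * w) = modulus z * modulus w.
Proof. exact: ComplexField.Normc.normcM. Qed.

Lemma modulusV z : modulus z^-1 = (modulus z)^-1.
Proof. exact: ComplexField.Normc.normcV. Qed.

Lemma le_modulusD z w : modulus (z + w) <= modulus z + modulus w.
Proof. exact: le_normcD. Qed.

Lemma modulusN z : modulus (- z) = modulus z.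
Proof. exact: normcN. Qed.

Lemma le_modulusB z w : modulus (z - w) <= modulus z + modulus w.
Proof. by rewrite -(modulusN w); exact: le_modulusD. Qed.

Lemma modulusX z k : modulus (z ^+ k) = modulus z ^+ k.
Proof.
elim: k => [|k IH]; last by rewrite !exprS modulusM IH.
by rewrite !expr0; exact: ComplexField.Normc.normc1.
Qed.

Lemma modulus_ge0 z : 0 <= modulus z. Proof. by case: z => x y; exact: sqrtr_ge0. Qed.

Lemma modulusR x : modulus x%:C%C = `|x|.
Proof. by rewrite /modulus /= expr0n addr0 sqrtr_sqr. Qed.

Lemma le_Re_modulus z : `|complex.Re z| <= modulus z.
Proof. by case: z => x y; rewrite /modulus /= -sqrtr_sqr ler_sqrt ?lerDl ?addr_ge0 ?sqr_ge0. Qed.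

Lemma le_Im_modulus z : `|complex.Im z| <= modulus z.
Proof. by case: z => x y; rewrite /modulus /= -sqrtr_sqr ler_sqrt ?lerDr ?addr_ge0 ?sqr_ge0. Qed.

Lemma le_modulus z : modulus z <= `|complex.Re z| + `|complex.Im z|.
Proof.
case: z => x y; rewrite /modulus /= -[leRHS]ger0_norm ?addr_ge0// -sqrtr_sqr.
rewrite ler_sqrt ?sqr_ge0// sqrrD !real_normK ?num_real//.
by rewrite lerD2r lerDl mulrn_wge0// mulr_ge0.
Qed.

Lemma normC_modulus z : `|z| = (modulus z)%:C%C.
Proof. by case: z. Qed.

(** Euler's [exp (s + i t)], as a function of two real variables. *)
Definition expi s t : C := (expR s)%:C%C * (cos t +i* sin t)%C.

Lemma cis_modulus t : modulus (cos t +i* sin t)%C = 1.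
Proof. by rewrite /modulus/= cos2Dsin2 sqrtr1. Qed.

Lemma expi_modulus s t : modulus (expi s t) = expR s.
Proof. by rewrite modulusM cis_modulus mulr1 modulusR ger0_norm// expR_ge0. Qed.

Lemma expiD s t x y : expi (s + x) (t + y) = expi s t * expi x y.
Proof.
rewrite /expi expRD; apply/eqP; rewrite eq_complex /= cosD sinD.
by apply/andP; split; apply/eqP; ring.
Qed.

Lemma expi2pi s t : expi s (t + 2 * pi) = expi s t.
Proof. by rewrite /expi mulrC -[t + _ * _]/(t + _) (mulrC 2) mulr_natr cosD2pi sinD2pi mulrC. Qed.

Lemma is_derive_first_order (f : R -> R) x (d : R) : is_derive x 1 f d ->
  forall e, 0 < e -> exists2 h : R, 0 < h &
  forall y, `|y| < h -> `|f (x + y) - f x - d * y| <= e * `|y|.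
Proof.
move=> [dxf fd] e e0.
have : (fun h : R => h^-1 *: ((f \o shift x) (h *: (1 : R)) - f x)) @ 0^' --> d.
  by rewrite -fd; exact: dxf.
move=> /cvgrPdist_le /(_ _ e0) /nbhs_ballP[h /= h0 H].
exists h => // y yh; have [->|y0] := eqVneq y 0.
  by rewrite addr0 subrr mulr0 subr0 !normr0 mulr0.
have := H y; rewrite /ball/= sub0r normrN => /(_ yh y0).
rewrite /= [y *: _]mulr1 => H'.
rewrite (_ : f (x + y) - f x - d * y = (y^-1 * (f (y + x) - f x) - d) * y); last first.
  by rewrite [y + x]addrC; field.
by rewrite normrM ler_pM2r ?normr_gt0// distrC.
Qed.

Lemma expi_first_order e : 0 < e -> exists2 h : R, 0 < h &
  forall x y, `|x| < h -> `|y| < h ->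
    modulus (expi x y - 1 - (x +i* y)%C) <= e * (`|x| + `|y|).
Proof.
move=> e0; pose e1 : R := Num.min 1 (e / 8).
have e10 : 0 < e1 by rewrite lt_min ltr01 divr_gt0.
have e11 : e1 <= 1 by rewrite ge_min lexx.
have e18 : 8 * e1 <= e by rewrite mulrC -ler_pdivlMr// ge_min lexx orbT.
clearbody e1.
have [h1 h10 H1] := is_derive_first_order (is_derive_expR (0 : R)) e10.
have [h2 h20 H2] := is_derive_first_order (is_derive_cos (0 : R)) e10.
have [h3 h30 H3] := is_derive_first_order (is_derive_sin (0 : R)) e10.
exists (Num.min e1 (Num.min h1 (Num.min h2 h3))).
  by rewrite !lt_min e10 h10 h20 h30.
move=> x y; rewrite !lt_min => /and4P[xe x1 _ _] /and4P[_ _ y2 y3].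
have := H1 x x1; have := H2 y y2; have := H3 y y3.
rewrite !add0r expR0 cos0 sin0 oppr0 mul0r mul1r !subr0 addr0 !mul1r => A B D.
apply: le_trans (le_modulus _) _; rewrite /expi /= !mul0r !subr0 !addr0.
set E := expR x; rewrite -/E in D.
have E0 : 0 <= E by exact: expR_ge0.
have E1 : `|E - 1| <= 2 * `|x|.
  rewrite -[E - 1](subrK x) (le_trans (ler_normD _ _))//.
  by have := normr_ge0 x; move: D e11; clear; nra.
have E3 : E <= 3.
  have := ler_norm (E - 1); move: E1 xe e11; clear; lra.
have -> : E * cos y - 1 - x = (E - 1 - x) + E * (cos y - 1) by ring.
have -> : E * sin y - y = E * (sin y - y) + (E - 1) * y by ring.
have F1 : `|E * (cos y - 1)| <= 3 * (e1 * `|y|).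
  by rewrite normrM (ger0_norm E0) ler_pM.
have F2 : `|E * (sin y - y)| <= 3 * (e1 * `|y|).
  by rewrite normrM (ger0_norm E0) ler_pM.
have F3 : `|(E - 1) * y| <= 2 * e1 * `|y|.
  by rewrite normrM ler_wpM2r// (le_trans E1)// ler_wpM2l ?ltW.
have := ler_normD (E - 1 - x) (E * (cos y - 1)).
have := ler_normD (E * (sin y - y)) ((E - 1) * y).
move: F1 F2 F3 D; have := normr_ge0 x; have := normr_ge0 y; move: e18.
set X := `|x|; set Y := `|y|.
move=> e18 Y0 X0 F1 F2 F3 D G1 G2.
have : 8 * e1 * (X + Y) <= e * (X + Y) by rewrite ler_wpM2r// addr_ge0.
by have := mulr_ge0 (ltW e10) X0; move: F1 F2 F3 D G1 G2; clear; lra.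
Qed.

Definition complex_differentiable (G : C -> C) c := exists a,
  forall e : R, 0 < e -> exists2 h : R, 0 < h & forall c', modulus (c' - c) < h ->
    modulus (G c' - G c - a * (c' - c)) <= e * modulus (c' - c).

Lemma complex_differentiableZ (G : C -> C) c a : complex_differentiable G c ->
  complex_differentiable (fun c => a * G c) c.
Proof.
move=> [b H]; exists (a * b) => e e0.
have k0 : 0 < modulus a + 1 by rewrite ltr_wpDl// modulus_ge0.
have [h h0 {}H] := H (e / (modulus a + 1)) (divr_gt0 e0 k0).
exists h => // c' /H {}H.
rewrite -mulrA -!mulrBr modulusM.
apply: (@le_trans _ _ ((modulus a + 1) * (e / (modulus a + 1) * modulus (c' - c)))).
  by apply: ler_pM => //; rewrite ?modulus_ge0// lerDl.
by rewrite mulrA mulrC (mulrC _ (e / _)) divfK ?gt_eqF// mulrC.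
Qed.

Lemma complex_differentiable_continuous (G : C -> C) c :
  complex_differentiable G c -> forall e, 0 < e -> exists2 h : R, 0 < h &
  forall c', modulus (c' - c) < h -> modulus (G c' - G c) <= e.
Proof.
move=> [a H] e e0; have [h h0 {}H] := H 1 ltr01.
have k0 : 0 < modulus a + 1 by rewrite ltr_wpDl// modulus_ge0.
exists (Num.min h (e / (modulus a + 1))); first by rewrite lt_min h0 divr_gt0.
move=> c'; rewrite lt_min ltr_pdivlMr// => /andP[/H {}H /ltW ce].
apply: le_trans ce; rewrite mul1r in H.
rewrite -[G c' - G c](subrK (a * (c' - c))).
apply: le_trans (le_modulusD _ _) _; rewrite modulusM.
by rewrite [leRHS]mulrC [leRHS]mulrDl mul1r addrC lerD2l.
Qed.

(** In logarithmic polar coordinates the Cauchy-Riemann equations keep their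
    form, since [exp] is holomorphic. *)
Lemma cr_expi (G : C -> C) (a b c d : R) : b <= 0 ->
  (forall c, modulus c <= 1 -> complex_differentiable G c) ->
  cr_on a b c d (fun s t => complex.Re (G (expi s t)))
                (fun s t => complex.Im (G (expi s t))).
Proof.
move=> b0 dG x y; rewrite in_itv/= => xb _.
set z := expi x y.
have z1 : modulus z <= 1.
  by rewrite expi_modulus -expR0 ler_expR; apply: le_trans b0; move/andP: xb => [].
have [A HA] := dG z z1.
exists (complex.Re (A * z)), (- complex.Im (A * z)), (complex.Im (A * z)).
move=> e e0.
have k0 : 0 < modulus A + 1 by rewrite ltr_wpDl// modulus_ge0.
pose e1 : R := Num.min 1 (e / 2 / (modulus A + 1)).
have e10 : 0 < e1 by rewrite lt_min ltr01 !divr_gt0.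
have e11 : e1 <= 1 by rewrite ge_min lexx.
have e12 : (modulus A + 1) * e1 <= e / 2.
  by rewrite mulrC -ler_pdivlMr// ge_min lexx orbT.
have [h1 h10 H1] := expi_first_order e10.
have e40 : 0 < e / 4 by rewrite divr_gt0.
have [h2 h20 H2] := HA (e / 4) e40.
exists (Num.min h1 (h2 / 4)); first by rewrite lt_min h10 divr_gt0.
move=> u v _ _; rewrite !lt_min => /andP[u1 u2] /andP[v1 v2].
have {H1} := H1 (u - x) (v - y) u1 v1.
set D := `|_| + `|_|; set E := expi _ _; set w := (_ +i* _)%C => HE.
have D0 : 0 <= D by rewrite addr_ge0.
have EE : expi u v - z = z * (E - 1).
  by rewrite mulrBr mulr1 /z /E -expiD !(addrC _ (_ - _)) !subrK.
have wD : modulus w <= D by exact: le_modulus.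
have E1 : modulus (E - 1) <= 2 * D.
  rewrite -[E - 1](subrK w) (le_trans (le_modulusD _ _))//.
  by move: HE wD e11 D0; clear; nra.
have zE : modulus (expi u v - z) <= 2 * D.
  by rewrite EE modulusM (le_trans _ E1)// ler_piMl// modulus_ge0.
have {}H2 : modulus (G (expi u v) - G z - A * (expi u v - z)) <= e / 4 * (2 * D).
  apply: le_trans (H2 _ _) _; last by rewrite ler_wpM2l// ltW.
  by apply: le_lt_trans zE _; move: u2 v2; rewrite /D; clear; lra.
have main : modulus (G (expi u v) - G z - A * z * w) <= e * D.
  have -> : G (expi u v) - G z - A * z * w =
      (G (expi u v) - G z - A * (expi u v - z)) + A * (z * (E - 1 - w)).
    by rewrite EE; ring.
  apply: le_trans (le_modulusD _ _) _; rewrite (modulusM A) (modulusM z).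
  have : modulus A * (modulus z * modulus (E - 1 - w)) <= (modulus A + 1) * (e1 * D).
    apply: ler_pM; rewrite ?mulr_ge0 ?modulus_ge0//; first by rewrite lerDl.
    by rewrite (le_trans _ HE)// ler_piMl// modulus_ge0.
  by move: H2 (ler_wpM2r D0 e12); clear; lra.
split; apply: le_trans main; [have := le_Re_modulus (G (expi u v) - G z - A * z * w)|
  have := le_Im_modulus (G (expi u v) - G z - A * z * w)]; apply: le_trans;
  rewrite /w; case: (A * z) (G (expi u v)) (G z) => p q [? ?] [? ?] /=;
  by rewrite le_eqVlt; apply/orP; left; apply/eqP; congr `|_|; ring.
Qed.

End complex_plane.

Section differentiable_complex.
Context {R : realType}.
Local Notation C := R[i].

Lemma gt0_complex (e : C) : 0 < e -> e = (complex.Re e)%:C%C /\ 0 < complex.Re e.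
Proof. by case: e => x y; rewrite ltcE /= => /andP[/eqP -> ?]. Qed.

Lemma differentiable_complex (G : C -> C) c : differentiable G c ->
  complex_differentiable G c.
Proof.
move=> /derivable1_diffP; rewrite /derivable.
set F := (fun h : C => _) => /cvg_ex[/= a] /cvgrPdist_le Fa.
exists a => e e0.
have e0' : 0 < e%:C%C :> C by rewrite ltcR.
have /nbhs_ballP[r /= /gt0_complex[-> r0] H] := Fa _ e0'.
exists (complex.Re r) => // c' cr.
have [->|cc'] := eqVneq c' c.
  by rewrite !subrr mulr0 subr0 modulus0 mulr0.
have d0 : c' - c != 0 by rewrite subr_eq0.
have := H (c' - c); rewrite /ball/= sub0r normrN normC_modulus ltcR => /(_ cr d0).
rewrite /F normC_modulus lecR /= /shift => {}H.
have -> : G c' - G c - a * (c' - c) = ((c' - c)^-1 * (G ((c' - c) *: 1 + c) - G c) - a) * (c' - c).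
  have -> : (c' - c) *: (1 : C) = c' - c by exact: mulr1.
  by rewrite subrK; field.
by rewrite modulusM ler_wpM2r ?modulus_ge0// -modulusN opprB.
Qed.

End differentiable_complex.

(** * Riemann sums of periodic functions *)

Section segment_lemmas.
Context {R : realType}.
Implicit Types (f : R -> R) (a b x e : R).

Lemma segint_le f a b (k : R) : a <= b -> {within `[a, b], continuous f} ->
  (forall x, x \in `[a, b] -> f x <= k) -> segint f a b <= k * (b - a).
Proof.
move=> ab cf fk; rewrite -segint_cst//; apply: le_Rintegral => //.
  exact: integrable_itv.
by apply: integrable_itv => x; exact: cst_continuous.
Qed.

Lemma continuous_firstP f : (forall x, forall e : R, 0 < e -> exists2 d : R, 0 < d &
    forall y, `|y - x| < d -> `|f y - f x| <= e) <-> continuous f.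
Proof.
split=> [H x|cf x e e0].
  apply/cvgrPdist_le => e e0; have [d d0 Hd] := H x e e0.
  by apply/nbhs_ballP; exists d => //= y; rewrite /ball/= distrC => /Hd; rewrite distrC.
have /cvgrPdist_le/(_ e e0)/nbhs_ballP[d /= d0 H] := cf x.
by exists d => // y yx; have := H y; rewrite /ball/= !(distrC x) (distrC (f x)); exact.
Qed.

(** By compactness; [P] is not supposed monotone in [d], so that each point
    has to provide all the small scales. *)
Lemma segment_uniform_scale a b (P : R -> R -> Prop) :
  (forall x, x \in `[a, b] -> exists2 h : R, 0 < h &
     forall d y, 0 < d -> d < h -> `|y - x| < h -> P d y) ->
  exists2 d : R, 0 < d & forall x, x \in `[a, b] -> P d x.
Proof.
move=> H.
have : \forall d \near 0^'+, `[a, b]%classic `<=` P d.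
  apply: (compact_near_coveringP _).1; first exact: segment_compact.
  move=> x xab; have [h h0 {}H] := H x xab.
  exists (ball x h, [set d : R | 0 < d < h]).
    split=> /=; first exact: nbhsx_ballx.
    near=> d; apply/andP; split; near: d; first exact: nbhs_right_gt.
    exact: nbhs_right_lt.
  by move=> [y d]/= [xy /andP[d0 dh]]; apply: H => //; rewrite distrC.
move=> /nbhs_ballP[r /= r0 {}H]; exists (r / 2); first by rewrite divr_gt0.
move=> x xab; apply: (H (r / 2)) => //; last by rewrite divr_gt0.
by rewrite /ball/= sub0r normrN gtr0_norm ?divr_gt0// gtr_pMr// invf_lt1// ltr1n.
Unshelve. all: by end_near. Qed.

Lemma segment_uniform_continuous f a b e : continuous f -> 0 < e ->
  exists2 d : R, 0 < d & forall x, x \in `[a, b] ->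
    forall y, `|y - x| <= d -> `|f y - f x| <= e.
Proof.
move=> /continuous_firstP cf e0.
apply: segment_uniform_scale => x _.
have e20 : 0 < e / 2 by rewrite divr_gt0.
have [h h0 H] := cf x (e / 2) e20.
exists (h / 2); first by rewrite divr_gt0.
move=> d x' d0 dh x'x y yx'.
have -> : f y - f x' = (f y - f x) - (f x' - f x) by ring.
rewrite (splitr e); apply: le_trans (ler_normB _ _) _; apply: lerD; apply: H.
  rewrite (splitr h) -[y - x](subrKA x') (le_lt_trans (ler_normD _ _))//.
  by rewrite ltrD// (le_lt_trans yx').
by rewrite (lt_le_trans x'x)// ler_pdivrMr// ler_peMr ?(ltW h0)// ler1n.
Qed.

(** Riemann sums of a continuous periodic function over the regular grids
    based at [th] converge uniformly in [th]: the sum is compared with an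
    increment of a primitive over the period [th, th + T] by the mean value
    theorem. Uniformity matters because the base point that [center_le_grid]
    provides varies with the grid in an uncontrolled way. *)
Lemma uniform_riemann_sum f (T : R) : continuous f -> 0 < T ->
  (forall x, f (x + T) = f x) ->
  forall e, 0 < e -> exists N0 : nat, forall N, (N0 <= N)%N -> (0 < N)%N ->
  forall th, th \in `[0, T] ->
    `|(\sum_(j < N) f (th + T * j%:R / N%:R)) / N%:R - segint f 0 T / T| <= e.
Proof.
move=> cf T0 fT e e0.
have cfw a b : {within `[a, b], continuous f} by exact: continuous_subspaceT.
pose F := segint f (-1).
have dF x : -1 < x -> is_derive x 1 F (f x).
  move=> x1.
  have [dF fx] : derivable F x 1 /\ derive1 F x = f x.
    apply: (@continuous_FTC1_closed _ f (-1) x (x + 1)) => //.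
    - by rewrite ltrDl.
    - exact: integrable_itv.
    - exact: cf.
  by apply: DeriveDef; [exact: dF|rewrite -derive1E fx].
have cF a b : -1 < a -> {within `[a, b], continuous F}.
  move=> a1; apply/subspace_continuousP => x; rewrite /= in_itv/= => /andP[ax _].
  have /@ex_derive/derivable1_diffP/differentiable_continuous := dF x (lt_le_trans a1 ax).
  by move=> cFx; apply: cvg_trans cFx; apply: cvg_app; exact: cvg_within.
have N1 : -1 < 0 :> R by rewrite ltrN10.
have FT th : th \in `[0, T] -> F (th + T) - F th = segint f 0 T.
  rewrite in_itv/= => /andP[th0 thT].
  have -> : segint f 0 T = F (0 + T) - F 0.
    rewrite add0r /F (@segint_split _ f (-1) T 0) ?lerN10 ?(ltW T0)//.
    by rewrite addrC addKr.
  pose D x := F (x + T) - F x.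
  have dD x : x \in `]0, th[ -> is_derive x 1 D 0.
    rewrite in_itv/= => /andP[x0 _].
    have h1 := dF _ (lt_trans N1 x0).
    have h2 := dF _ (lt_trans N1 (addr_gt0 x0 T0)).
    have h3 : is_derive x 1 (fun x => F (x + T)) (f (x + T)).
      have := @is_derive1_comp _ F (fun x => x + T) x (f (x + T)) 1 h2 _.
      rewrite mulr1; apply.
      rewrite -[X in is_derive _ _ _ X]addr0; exact: is_deriveD.
    rewrite (_ : 0 = f (x + T) - f x); last by rewrite fT subrr.
    exact: is_deriveB.
  have cD : {within `[0, th], continuous D}.
    apply: within_continuousB; last exact: cF.
    apply/subspace_continuousP => x; rewrite /= in_itv/= => /andP[x0 _].
    have /@ex_derive/derivable1_diffP/differentiable_continuous cFx :=
      dF _ (lt_le_trans N1 (addr_ge0 x0 (ltW T0))).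
    apply: cvg_within_filter; apply: (@continuous_comp _ _ _ (fun x => x + T) F) => //.
    by apply: cvgD => //; exact: cvg_cst.
  have [c _] := @MVT_segment _ D (fun=> 0) 0 th th0 dD cD.
  by rewrite mul0r => /eqP; rewrite subr_eq0 => /eqP.
have [d d0 Hd] := segment_uniform_continuous 0 (2 * T) cf e0.
exists (Num.bound (T / d)) => N N0 Npos th thT.
have N0' : 0 < N%:R :> R by rewrite ltr0n.
have TN : T / N%:R <= d.
  rewrite ler_pdivrMr// mulrC -ler_pdivrMr// ltW//.
  by apply: lt_le_trans (archi_boundP _) _; rewrite ?ler_nat// divr_ge0 ?ltW.
have TN0 : 0 < T / N%:R by rewrite divr_gt0.
pose p j : R := th + T * j%:R / N%:R.
have pS j : p j.+1 = p j + T / N%:R by rewrite /p -addn1 natrD; field; rewrite gt_eqF.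
have th0 : 0 <= th by move: thT; rewrite in_itv/= => /andP[].
have p0 j : 0 <= p j by rewrite addr_ge0// divr_ge0 ?mulr_ge0// ltW.
have pT j : (j < N)%N -> p j <= 2 * T.
  move=> jN; rewrite /p [leRHS]mulrDl !mul1r lerD//.
    by move: thT; rewrite in_itv/= => /andP[].
  by rewrite ler_pdivrMr// ler_pM2l// ler_nat ltnW.
have step j : (j < N)%N -> `|f (p j) * (T / N%:R) - (F (p j.+1) - F (p j))| <= e * (T / N%:R).
  move=> jN.
  have pp : p j <= p j.+1 by rewrite pS lerDl ltW.
  have := @MVT_segment _ F f (p j) (p j.+1) pp.
  case=> [x||c]; [|exact: cF (lt_le_trans N1 (p0 j))|].
    by rewrite in_itv/= => /andP[px _]; apply: dF; rewrite (lt_trans _ px)// (lt_le_trans N1).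
  rewrite in_itv/= => /andP[pc cp] ->.
  have -> : p j.+1 - p j = T / N%:R by rewrite pS addrAC subrr add0r.
  rewrite -mulrBl normrM (gtr0_norm TN0) ler_wpM2r ?(ltW TN0)// distrC.
  apply: Hd; first by rewrite in_itv/= p0 pT.
  rewrite ger0_norm ?subr_ge0//; apply: le_trans TN.
  by move: cp; rewrite pS -lerBlDl.
have Ftel : \sum_(j < N) (F (p j.+1) - F (p j)) = segint f 0 T.
  rewrite -(FT _ thT) -(big_mkord xpredT (fun j => F (p j.+1) - F (p j))) telescope_sumr//.
  by rewrite /p mulr0 mul0r addr0 mulfK ?gt_eqF.
rewrite -(ler_pM2r T0) -[X in _ * X <= _](gtr0_norm T0) -normrM.
have -> : ((\sum_(j < N) f (th + T * j%:R / N%:R)) / N%:R - segint f 0 T / T) * T =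
    \sum_(j < N) (f (p j) * (T / N%:R) - (F (p j.+1) - F (p j))).
  rewrite sumrB Ftel mulrBl divfK ?gt_eqF//; congr (_ - _).
  by rewrite -mulr_suml -mulrA [_^-1 * T]mulrC.
apply: le_trans (ler_norm_sum _ _ _) _.
apply: (@le_trans _ _ (\sum_(j < N) e * (T / N%:R))).
  by apply: ler_sum => j _; exact: step.
by rewrite sumr_const card_ord -[leLHS]mulr_natr -mulrA divfK ?gt_eqF.
Qed.

End segment_lemmas.

(** * Circular means and the maximum principle *)

Section circle_means.
Context {R : realType}.
Local Notation C := R[i].
Implicit Types (G : C -> C) (c : C) (p : R) (psi : R -> R).

Lemma powR_continuous_ge0 p (x : R) : 0 < p -> 0 <= x -> forall e : R, 0 < e ->
  exists2 h : R, 0 < h & forall y, 0 <= y -> `|y - x| < h ->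
    `|y `^ p - x `^ p| <= e.
Proof.
move=> p0 x0 e e0; have [xp|x0'] := ltP 0 x.
  have /differentiable_continuous/cvgrPdist_le/(_ e e0)/nbhs_ballP[h /= h0 H] :
      differentiable (fun y : R => y `^ p) x.
    by apply/derivable1_diffP; have [] := @is_derive1_powR R p x xp.
  exists h => // y _ yx; rewrite distrC; apply: H.
  by rewrite /ball/= distrC.
have -> : x = 0 by apply/eqP; rewrite eq_le x0' x0.
exists (e `^ p^-1); first exact: powR_gt0.
move=> y y0; rewrite subr0 (ger0_norm y0) powR0 ?gt_eqF// subr0 => ye.
rewrite ger0_norm ?powR_ge0//.
have -> : e = (e `^ p^-1) `^ p by rewrite -powRrM mulVf ?gt_eqF// powRr1// ltW.
by apply: ge0_ler_powR; rewrite ?nnegrE ?powR_ge0// ltW.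
Qed.

Lemma prod_powR (I : finType) (F : I -> R) p : 0 < p -> (forall i, 0 <= F i) ->
  (\prod_i F i) `^ p = \prod_i F i `^ p.
Proof.
move=> p0 F0; apply: (@proj2 (0 <= \prod_i F i)).
elim/big_rec2: _ => [|i x y _ [y0 <-]]; first by rewrite powR1.
by rewrite mulr_ge0// powRM.
Qed.

Lemma expi_continuous t : forall e : R, 0 < e -> exists2 h : R, 0 < h &
  forall t', `|t' - t| < h -> modulus (expi 0 t' - expi 0 t) <= e.
Proof.
move=> e e0; have [h h0 H] := @expi_first_order R 1 ltr01.
exists (Num.min h (e / 2)); first by rewrite lt_min h0 divr_gt0.
move=> t'; rewrite lt_min => /andP[t'h t'e].
have -> : expi 0 t' - expi 0 t = expi 0 t * (expi 0 (t' - t) - 1).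
  by rewrite mulrBr mulr1 -expiD addr0 [t + _]addrC subrK.
rewrite modulusM expi_modulus expR0 mul1r.
have := H 0 (t' - t); rewrite normr0 => /(_ h0 t'h); rewrite add0r mul1r => {}H.
rewrite -[X in modulus X](subrK (0 +i* (t' - t))%C) (le_trans (le_modulusD _ _))//.
have := le_modulus (0 +i* (t' - t))%C; rewrite [complex.Re _]/= [complex.Im _]/= normr0 add0r.
by move: H t'e; clear; lra.
Qed.

Lemma circle_modulus_continuous G :
  (forall c, modulus c <= 1 -> complex_differentiable G c) ->
  continuous (fun t => modulus (G (expi 0 t))).
Proof.
move=> dG; apply/continuous_firstP => t e e0.
have c1 : modulus (expi 0 t) <= 1 by rewrite expi_modulus expR0.
have [h h0 H] := complex_differentiable_continuous (dG _ c1) e0.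
have h20 : 0 < h / 2 by rewrite divr_gt0.
have [k k0 K] := expi_continuous t h20.
exists k => // t' /K {}K.
have {}H : modulus (G (expi 0 t') - G (expi 0 t)) <= e.
  by apply: H; rewrite (le_lt_trans K)// ltr_pdivrMr// ltr_pMr// ltr1n.
set a := G _ in H *; set b := G _ in H *.
rewrite ler_norml lerBlDr lerNl opprB lerBlDr.
have := le_modulusD (a - b) b; have := le_modulusD (b - a) a; rewrite !subrK.
by rewrite -(modulusN (b - a)) opprB; move: H; clear; lra.
Qed.

(** Cauchy's mean value theorem for the real part, in one inequality: the
    circular means do not depend on the radius and tend to the value at the
    centre. *)
Lemma Re_center_le G (M : R) :
  (forall c, modulus c <= 1 -> complex_differentiable G c) ->
  (forall t, complex.Re (G (expi 0 t)) <= M) -> complex.Re (G 0) <= M.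
Proof.
move=> dG GM; rewrite leNgt; apply/negP => MG.
pose e : R := complex.Re (G 0) - M.
have e20 : 0 < e / 2 by rewrite divr_gt0// subr_gt0.
have m0 : modulus (0 : C) <= 1 by rewrite modulus0.
have [h h0 H] := complex_differentiable_continuous (dG _ m0) e20.
pose s : R := Num.min 0 (ln (h / 2)).
have s0 : s <= 0 by rewrite ge_min lexx.
have sh : expR s < h.
  have h20 : 0 < h / 2 by rewrite divr_gt0.
  apply: (@le_lt_trans _ _ (h / 2)).
    by rewrite -[leRHS]lnK ?posrE// ler_expR ge_min lexx orbT.
  by rewrite ltr_pdivrMr// ltr_pMr// ltr1n.
have pi20 : 0 < 2 * pi :> R by rewrite mulr_gt0// pi_gt0.
pose P u t := complex.Re (G (expi u t)); pose Q u t := complex.Im (G (expi u t)).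
have cr : cr_on s 0 0 (2 * pi) P Q by exact: cr_expi.
have := goursat_rectangle s0 (ltW pi20) cr; rewrite /boundint.
have -> : segint (fun x => Q x 0 - Q x (2 * pi)) s 0 = 0.
  rewrite (_ : (fun x => _) = (fun=> 0)); last first.
    by apply/funext => x; rewrite /Q -[2 * pi]add0r expi2pi subrr.
  by rewrite segint_cst// mul0r.
rewrite add0r => /eqP; apply/negP; rewrite lt_eqF//.
have s00 : s \in `[s, 0] by rewrite in_itv/= lexx.
have s01 : 0 \in `[s, 0] by rewrite in_itv/= s0 lexx.
have c1 := cr_conty cr (or_introl erefl) s00.
have c2 := cr_conty cr (or_introl erefl) s01.
apply: (@le_lt_trans _ _ (- (e / 2) * (2 * pi - 0))); last first.
  by rewrite subr0 mulNr oppr_lt0 mulr_gt0.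
apply: segint_le; [exact: ltW|exact: within_continuousB|].
move=> t _; have := H (expi s t); rewrite subr0 expi_modulus => /(_ sh) {}H.
have := le_Re_modulus (G (expi s t) - G 0).
have := GM t; rewrite -/(P 0 t).
have -> : complex.Re (G (expi s t) - G 0) = P s t - complex.Re (G 0).
  by rewrite /P; case: (G _) (G _) => ? ? [].
by rewrite ler_norml /e in H * => ? /andP[? ?]; move: H; rewrite /e; lra.
Qed.

Lemma maximum_modulus G (M : R) :
  (forall c, modulus c <= 1 -> complex_differentiable G c) ->
  (forall t, modulus (G (expi 0 t)) <= M) -> modulus (G 0) <= M.
Proof.
move=> dG GM; have [->|G0] := eqVneq (G 0) 0.
  by rewrite modulus0 (le_trans _ (GM 0))// modulus_ge0.
have G0' : modulus (G 0) != 0 by apply: contra_neq G0 => /modulus_eq0.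
(* rotate so that the value at the centre becomes a nonnegative real *)
pose a : C := (modulus (G 0))%:C%C / G 0.
have a1 : modulus a = 1.
  by rewrite modulusM modulusV modulusR ger0_norm ?modulus_ge0// mulfV.
have -> : modulus (G 0) = complex.Re (a * G 0) by rewrite /a divfK.
apply: (@Re_center_le (fun c => a * G c)).
  by move=> c c1; apply: complex_differentiableZ; exact: dG.
move=> t; apply: le_trans (ler_norm _) (le_trans (le_Re_modulus _) _).
by rewrite modulusM a1 mul1r.
Qed.

End circle_means.

(** * The weighted submean inequality *)

Section log_submean.
Context {R : realType}.
Local Notation C := R[i].
Implicit Types (G : C -> C) (p : R) (psi : R -> R).

Lemma differentiable_prod (V : normedModType C) (I : Type) (s : seq I)
    (F : I -> V -> C) (x : V) : (forall i, differentiable (F i) x) ->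
  differentiable (fun y => \prod_(i <- s) F i y) x.
Proof.
move=> dF; elim: s => [|i s IH].
  by under eq_fun do rewrite big_nil; exact: differentiable_cst.
by under eq_fun do rewrite big_cons; exact: (differentiableM (dF i) IH).
Qed.

Lemma differentiable_rotate G (a c : C) : differentiable G (a * c) ->
  differentiable (fun c => G (a * c)) c.
Proof.
move=> dG.
have da : differentiable (fun c : C => a * c) c.
  by have [da _] := @is_diff_scaler _ R[i] a c; exact: da.
exact: (differentiable_comp da dG).
Qed.

(** The product of [G] over the [N] rotations by roots of unity takes the value
    [G 0 ^+ N] at the centre; the maximum principle turns this into a bound by
    a geometric mean over a regular grid. *)
Lemma center_le_grid G N : (0 < N)%N ->
  (forall c, modulus c <= 1 -> differentiable G c) ->
  exists2 th : R, th \in `[0, 2 * pi] &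
    modulus (G 0) ^+ N <=
      \prod_(j < N) modulus (G (expi 0 (th + 2 * pi * j%:R / N%:R))).
Proof.
move=> N0 dG.
pose H c := \prod_(j < N) G (expi 0 (2 * pi * j%:R / N%:R) * c).
have dH c : modulus c <= 1 -> complex_differentiable H c.
  move=> c1; apply: differentiable_complex; apply: differentiable_prod => j.
  apply: differentiable_rotate; apply: dG.
  by rewrite modulusM expi_modulus expR0 mul1r.
have HE t : modulus (H (expi 0 t)) =
    \prod_(j < N) modulus (G (expi 0 (t + 2 * pi * j%:R / N%:R))).
  rewrite /H (big_morph _ modulusM (ComplexField.Normc.normc1 R)).
  by apply: eq_bigr => j _; rewrite -expiD addr0 addrC.
have pi20 : 0 <= 2 * pi :> R by rewrite mulr_ge0// pi_ge0.
have [th thpi thmax] := EVT_max pi20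
  (continuous_subspaceT (circle_modulus_continuous dH)).
exists th => //; rewrite -HE.
have -> : modulus (G 0) ^+ N = modulus (H 0).
  rewrite /H (big_morph _ modulusM (ComplexField.Normc.normc1 R)).
  by under eq_bigr do rewrite mulr0; rewrite prodr_const card_ord.
apply: maximum_modulus => // t.
(* reduce t modulo the period *)
pose k := Num.floor (t / (2 * pi)).
have per (m : int) x : expi 0 (x + 2 * pi * m%:~R) = expi 0 x :> C.
  have pern (i : nat) y : expi 0 (y + 2 * pi * i%:R) = expi 0 y :> C.
    elim: i => [|i IH]; first by rewrite mulr0 addr0.
    have -> : y + 2 * pi * i.+1%:R = y + 2 * pi * i%:R + 2 * pi by rewrite -natr1; ring.
    by rewrite expi2pi.
  case: m => i; first exact: pern.
  by rewrite -(pern i.+1) NegzE mulrNz mulrN subrK.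
have pi2 : 0 < 2 * pi :> R by rewrite mulr_gt0// pi_gt0.
have -> : expi 0 t = expi 0 (t - 2 * pi * k%:~R) :> C.
  by rewrite -[LHS](per (- k)) mulrNz mulrN.
apply: thmax; rewrite in_itv/= subr_ge0 lerBlDr.
have /andP[h1 h2] := floor_itv (t / (2 * pi)); rewrite -/k in h1 h2.
rewrite ler_pdivlMr// in h1; rewrite ltr_pdivrMr// intrD in h2.
by move: h1 h2; clear; lra.
Qed.

(** Jensen's inequality [log |G 0| <= mean (log |G|)] combined with the
    convexity of [exp], in a form without logarithms. *)
Lemma weighted_submean G psi p :
  (forall c, modulus c <= 1 -> differentiable G c) ->
  continuous psi -> (forall t, psi (t + 2 * pi) = psi t) -> 0 < p ->
  modulus (G 0) `^ p * expR (- p * (segint psi 0 (2 * pi) / (2 * pi))) <=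
  segint (fun t => modulus (G (expi 0 t)) `^ p * expR (- p * psi t)) 0 (2 * pi)
    / (2 * pi).
Proof.
move=> dG cpsi ppsi p0.
pose k t := modulus (G (expi 0 t)) `^ p * expR (- p * psi t).
rewrite -/k; set B := segint psi _ _ / _; set K := segint k _ _ / _.
have cGp : continuous (fun t => modulus (G (expi 0 t)) `^ p).
  have := circle_modulus_continuous (fun c h => differentiable_complex (dG c h)).
  move=> /continuous_firstP cG; apply/continuous_firstP => {}t e e0.
  have [h h0 H] := powR_continuous_ge0 p0 (modulus_ge0 (G (expi 0 t))) e0.
  have h20 : 0 < h / 2 by rewrite divr_gt0.
  have [r r0 {}cG] := cG t _ h20.
  exists r => // y /cG yt; apply: H; first exact: modulus_ge0.
  by rewrite (le_lt_trans yt)// ltr_pdivrMr// ltr_pMr// ltr1n.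
have ck : continuous k.
  move=> t; apply: cvgM; first exact: cGp.
  apply: (@continuous_comp _ _ _ (fun t => - p * psi t) expR); last exact: continuous_expR.
  by apply: cvgM; [exact: cvg_cst|exact: cpsi].
have pk t : k (t + 2 * pi) = k t by rewrite /k expi2pi ppsi.
have pi2 : 0 < 2 * pi :> R by rewrite mulr_gt0// pi_gt0.
have k0 t : 0 <= k t by rewrite mulr_ge0 ?powR_ge0 ?expR_ge0.
have K0 : 0 <= K.
  by rewrite divr_ge0 ?(ltW pi2)//; apply: Rintegral_ge0 => t _; exact: k0.
set A := modulus (G 0) `^ p.
have A0 : 0 <= A by exact: powR_ge0.
have main e : 0 < e -> A * expR (- p * (B + e)) <= K + e.
  move=> e0.
  have [N1 HN1] := uniform_riemann_sum cpsi pi2 ppsi e0.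
  have [N2 HN2] := uniform_riemann_sum ck pi2 pk e0.
  pose N := (maxn N1 N2).+1.
  have N0 : (0 < N)%N by [].
  have [th thpi grid] := center_le_grid N0 dG.
  have := HN1 N (leqW (leq_maxl _ _)) N0 th thpi; rewrite -/B.
  have := HN2 N (leqW (leq_maxr _ _)) N0 th thpi; rewrite -/K.
  set t := fun j : 'I_N => th + 2 * pi * j%:R / N%:R.
  rewrite -[\sum_(j < N) k _]/(\sum_j k (t j)) -[\sum_(j < N) psi _]/(\sum_j psi (t j)).
  rewrite !ler_distl => /andP[_ Hk] /andP[_ Hpsi].
  have N0' : 0 < N%:R :> R by rewrite ltr0n.
  rewrite ler_pdivrMr// in Hpsi.
  have Ke : 0 <= K + e by rewrite addr_ge0// ltW.
  rewrite -(@ler_pXn2r _ N)// ?nnegrE ?mulr_ge0 ?expR_ge0//.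
  apply: (@le_trans _ _ (\prod_j k (t j))).
    rewrite /k big_split/= exprMn -expR_sum -prod_powR//; last by move=> j; exact: modulus_ge0.
    apply: ler_pM; rewrite ?exprn_ge0 ?expR_ge0//.
      rewrite /A -powR_mulrn ?powR_ge0// -powRrM mulrC powRrM powR_mulrn ?modulus_ge0//.
      apply: ge0_ler_powR; rewrite ?nnegrE ?exprn_ge0 ?modulus_ge0 ?(ltW p0)//.
      by apply: prodr_ge0 => j _; exact: modulus_ge0.
    rewrite -expRM_natr ler_expR -mulr_sumr -mulrA !mulNr lerN2.
    by rewrite ler_pM2l.
  have := (leif_AGM (A := [pred j : 'I_N | true]) (E := k \o t)).
  rewrite /= => /(_ (fun i _ => k0 (t i))) [+ _].
  rewrite (eq_card (B := [pred j : 'I_N | true]))// cardT size_enum_ord.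
  move=> /le_trans; apply; rewrite ler_pXn2r// ?nnegrE//.
  by rewrite divr_ge0// sumr_ge0.
apply/ler_addgt0Pr => e e0.
have c0 : 0 < 1 + A * p * expR (- p * B) by rewrite ltr_pwDl// !mulr_ge0 ?expR_ge0 ?(ltW p0).
pose d : R := e / (1 + A * p * expR (- p * B)).
have d0 : 0 < d by rewrite divr_gt0.
have ed : d * (1 + A * p * expR (- p * B)) = e by rewrite divfK ?gt_eqF.
have := main d d0; rewrite mulrDr expRD mulrA => M.
have := expR_ge1Dx (- p * d); set X := expR (- p * d) in M * => HX.
have AB : 0 <= A * expR (- p * B) by rewrite mulr_ge0 ?expR_ge0.
have := ler_wpM2l AB HX; move: M ed; set Y := expR _.
clear; nra.
Qed.

End log_submean.

(** * Measure-preserving maps *)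

Section measure_preserving.
Local Open Scope ereal_scope.
Context {R : realType}.

Definition measure_preserving d (T : measurableType d)
    (mu : set T -> \bar R) (f : T -> T) :=
  measurable_fun [set: T] f /\
  forall A, measurable A -> mu (f @^-1` A) = mu A.

Lemma measurable_preimage d1 d2 (T1 : measurableType d1) (T2 : measurableType d2)
    (f : T1 -> T2) A : measurable_fun [set: T1] f -> measurable A ->
  measurable (f @^-1` A).
Proof. by move=> mf mA; rewrite -[X in measurable X]setTI; exact: mf. Qed.

Lemma measure_preserving_comp d (T : measurableType d) (mu : set T -> \bar R)
    (f g : T -> T) : measure_preserving mu f -> measure_preserving mu g ->
  measure_preserving mu (g \o f).
Proof.
move=> [mf fE] [mg gE]; split; first exact: measurableT_comp.
by move=> A mA; rewrite comp_preimage fE ?gE//; exact: measurable_preimage.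
Qed.

Lemma measure_preserving_integral d (T : measurableType d)
    (mu : {measure set T -> \bar R}) (f : T -> T) (H : T -> \bar R) :
  measure_preserving mu f -> measurable_fun setT H -> (forall x, 0 <= H x) ->
  \int[mu]_x H (f x) = \int[mu]_x H x.
Proof.
move=> [mf fE] mH H0.
have := ge0_integral_pushforward mf mu measurableT mH (fun x _ => H0 x).
rewrite preimage_setT => <-.
by apply: eq_measure_integral => A mA _; exact: fE.
Qed.

Section product.
Context d1 d2 (T1 : measurableType d1) (T2 : measurableType d2).
Variables (m1 : {sigma_finite_measure set T1 -> \bar R})
          (m2 : {sigma_finite_measure set T2 -> \bar R}).

Lemma measure_preserving_prod (f : T1 -> T1) (g : T2 -> T2) :
  measure_preserving m1 f -> measure_preserving m2 g ->
  measure_preserving (m1 \x m2) (fun x => (f x.1, g x.2)).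
Proof.
move=> [mf fE] [mg gE].
have mfg : measurable_fun setT (fun x : T1 * T2 => (f x.1, g x.2)).
  by apply/measurable_fun_pair; exact: measurableT_comp.
split=> // A mA; apply/esym.
apply: (@product_measure_unique _ _ _ _ _ m1 m2
  (pushforward (m1 \x m2) (fun x : T1 * T2 => (f x.1, g x.2)))) => //.
move=> B C mB mC.
transitivity ((m1 \x m2) ((f @^-1` B) `*` (g @^-1` C))) => //.
rewrite product_measure1E; try exact: measurable_preimage.
by congr (_ * _); [exact: fE|exact: gE].
Qed.

(** By Fubini: the vertical sections of a preimage are preimages, under the
    maps [g x], of the sections of the set. *)
Lemma measure_preserving_shearr (g : T1 -> T2 -> T2) :
  measurable_fun setT (fun x => g x.1 x.2) ->
  (forall x, measure_preserving m2 (g x)) ->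
  measure_preserving (m1 \x m2) (fun x => (x.1, g x.1 x.2)).
Proof.
move=> mg gp.
have mS : measurable_fun setT (fun x : T1 * T2 => (x.1, g x.1 x.2)).
  exact/measurable_fun_pair.
split=> // A mA; rewrite /product_measure1; apply: eq_integral => x _ /=.
have [mgx gE] := gp x.
transitivity (m2 (g x @^-1` xsection A x)); last by apply: gE; exact: measurable_xsection.
by rewrite !xsectionE.
Qed.

(** The horizontal sections are those of the iterated integral in the other
    order, which defines the same measure. *)
Lemma measure_preserving_shearl (f : T2 -> T1 -> T1) :
  measurable_fun setT (fun x => f x.2 x.1) ->
  (forall y, measure_preserving m1 (f y)) ->
  measure_preserving (m1 \x m2) (fun x => (f x.2 x.1, x.2)).
Proof.
move=> mf fp.
have mS : measurable_fun setT (fun x : T1 * T2 => (f x.2 x.1, x.2)).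
  exact/measurable_fun_pair.
have E12 A : measurable A -> (m1 \x m2) A = (m1 \x^ m2) A.
  apply: product_measure_unique => B C mB mC.
  exact: product_measure2E.
split=> // A mA; rewrite !E12//; last exact: measurable_preimage.
rewrite /product_measure2; apply: eq_integral => y _ /=.
have [mfy fE] := fp y.
transitivity (m1 (f y @^-1` ysection A y)); last by apply: fE; exact: measurable_ysection.
by rewrite !ysectionE.
Qed.

End product.

Lemma lebesgue_measure_translate (a : R) :
  measure_preserving (@lebesgue_measure R)
    (fun x : measurableTypeR R => (x + a)%R).
Proof.
pose f : measurableTypeR R -> measurableTypeR R := fun x => (x + a)%R.
have mf : measurable_fun setT f by exact: measurable_funD.
split=> // A mA; apply/esym.
pose nu : {measure set (measurableTypeR R) -> \bar R} :=
  measure_function_pushforward__canonical__measure_function_Measure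
    (@lebesgue_measure R) mf.
transitivity (nu A) => //; apply: lebesgue_measure_unique => // _ [[x y] _ <-].
transitivity (lebesgue_measure (`](x - a)%R, (y - a)%R]%classic : set R)); last first.
  congr lebesgue_measure; apply/seteqP.
  by split => z /=; rewrite !in_itv/= ltrBlDr lerBrDr.
have /= -> := @lebesgue_measure_itv R `]x, y].
have /= -> := @lebesgue_measure_itv R `](x - a)%R, (y - a)%R].
rewrite !lte_fin ltrD2r; case: ifP => // _.
by rewrite -!EFinB; congr _%:E; ring.
Qed.

End measure_preserving.

Section complex_lebesgue.
Context {R : realType}.
Local Notation C := R[i].
Local Notation R2 := (measurableTypeR R * measurableTypeR R)%type.
Local Notation mu2 := (@lebesgue_measure2 R).

Lemma lebesgue_measure2_shearl (a : R) :
  measure_preserving mu2 (fun x : R2 => (x.1 + - a * x.2, x.2)).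
Proof.
apply: (@measure_preserving_shearl _ _ _ _ _ (@lebesgue_measure R) (@lebesgue_measure R)
  (fun y x => x + - a * y)); last by move=> y; exact: lebesgue_measure_translate.
apply: measurable_funD => //.
exact: measurable_funM.
Qed.

Lemma lebesgue_measure2_shearr (a : R) :
  measure_preserving mu2 (fun x : R2 => (x.1, x.2 + a * x.1)).
Proof.
apply: (@measure_preserving_shearr _ _ _ _ _ (@lebesgue_measure R) (@lebesgue_measure R)
  (fun x y => y + a * x)); last by move=> y; exact: lebesgue_measure_translate.
apply: measurable_funD => //.
exact: measurable_funM.
Qed.

Definition rotation (c s : R) (x : R2) : R2 :=
  (c * x.1 - s * x.2, s * x.1 + c * x.2).

(** A rotation by an angle not a multiple of [pi] is a product of three
    shears; the remaining two are products of such rotations. *)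
Lemma lebesgue_measure2_rotation (c s : R) : c ^+ 2 + s ^+ 2 = 1 ->
  measure_preserving mu2 (rotation c s).
Proof.
have main c' s' : s' != 0 -> c' ^+ 2 + s' ^+ 2 = 1 ->
    measure_preserving mu2 (rotation c' s').
  move=> s0 cs; pose a := (1 - c') / s'.
  have as_ : a * s' = 1 - c' by rewrite divfK.
  have aE : a * (1 + c') = s'.
    apply: (mulIf s0); rewrite mulrAC as_ -expr2 -subr_sqr expr1n.
    by rewrite -cs addrC addKr.
  have := measure_preserving_comp (measure_preserving_comp
    (lebesgue_measure2_shearl a) (lebesgue_measure2_shearr s'))
    (lebesgue_measure2_shearl a).
  rewrite (_ : _ \o _ = rotation c' s')//; apply/funext => -[x y] /=.
  rewrite /rotation /=; congr (_, _); first last.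
    by rewrite mulrDr mulNr mulrN (mulrA s') (mulrC s' a) as_; ring.
  have -> : x + - a * y + - a * (y + s' * (x + - a * y)) =
    (1 - a * s') * x - a * (1 + (1 - a * s')) * y by ring.
  have -> : 1 - a * s' = c' by rewrite as_; ring.
  by rewrite aE.
move=> cs; have [s0|] := eqVneq s 0; last by move=> s0; exact: main.
have c0 : c != 0.
  by apply/eqP => c0; move: cs; rewrite c0 s0 expr0n addr0 => /eqP; rewrite eq_sym oner_eq0.
have r1 : measure_preserving mu2 (rotation 0 1).
  by apply: main; rewrite ?oner_eq0// expr0n add0r expr1n.
have r2 : measure_preserving mu2 (rotation s (- c)).
  by apply: main; rewrite ?oppr_eq0// sqrrN addrC.
have := measure_preserving_comp r1 r2.
rewrite (_ : _ \o _ = rotation c s)//; apply/funext => -[x y] /=.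
by rewrite /rotation /=; congr (_, _); ring.
Qed.

Lemma lebesgue_measure2_translate (a b : R) :
  measure_preserving mu2 (fun x : R2 => (x.1 + a, x.2 + b)).
Proof.
exact: (measure_preserving_prod (lebesgue_measure_translate a)
  (lebesgue_measure_translate b)).
Qed.

End complex_lebesgue.

Section tuples.
Local Open Scope ereal_scope.
Context {d : measure_display} {T : measurableType d} {R : realType}.
Variable mu : {sigma_finite_measure set T -> \bar R}.

Definition tuple_map n (f : 'I_n -> T -> T) (t : n.-tuple T) : n.-tuple T :=
  [tuple f i (tnth t i) | i < n].

Lemma measurable_tuple_map n (f : 'I_n -> T -> T) :
  (forall i, measurable_fun setT (f i)) -> measurable_fun setT (tuple_map f).
Proof.
move=> mf; apply/measurable_fun_tnthP => i.
rewrite (_ : _ \o _ = f i \o (@tnth _ T ^~ i)); last first.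
  by apply/funext => t /=; rewrite tnth_mktuple.
by apply: measurableT_comp => //; exact: measurable_tnth.
Qed.

Lemma measure_preserving_tuple n (f : 'I_n -> T -> T) :
  (forall i, measure_preserving mu (f i)) ->
  measure_preserving (tuple_measure mu n) (tuple_map f).
Proof.
elim: n f => [|n IH] f fp; split; try by apply: measurable_tuple_map => i; case: (fp i).
  move=> A mA /=; congr (\d_ _ _); apply/seteqP.
  by split=> t /=; rewrite (tuple0 (tuple_map f t)) (tuple0 t).
move=> A mA.
pose c (x : T * n.-tuple T) : n.+1.-tuple T := [tuple of x.1 :: x.2].
have mc : measurable_fun setT c by exact: measurable_cons.
have key x : tuple_map f (c x) =
    c (f ord0 x.1, tuple_map (fun i => f (lift ord0 i)) x.2).
  apply/eq_from_tnth => i; rewrite tnth_mktuple.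
  have [j ->|->] := unliftP ord0 i; last by rewrite !tnth0.
  by rewrite !tnthS tnth_mktuple.
transitivity ((mu \x tuple_measure mu n) (c @^-1` (tuple_map f @^-1` A))) => //.
transitivity ((mu \x tuple_measure mu n) (c @^-1` A)) => //.
have E : c @^-1` (tuple_map f @^-1` A) =
    (fun x => (f ord0 x.1, tuple_map (fun i => f (lift ord0 i)) x.2)) @^-1` (c @^-1` A).
  by apply/seteqP; split=> x; rewrite /preimage/= key.
rewrite E; have [_] := measure_preserving_prod (fp ord0) (IH _ (fun i => fp (lift ord0 i))).
by apply; exact: measurable_preimage.
Qed.

Lemma measurable_tuple_box n (A : set T) : measurable A ->
  measurable [set t : n.-tuple T | forall i, A (tnth t i)].
Proof.
move=> mA.
rewrite (_ : [set t | _] = \bigcap_(i in [set: 'I_n]) ((@tnth _ T ^~ i) @^-1` A)).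
  apply: fin_bigcap_measurable => // i _.
  by apply: measurable_preimage => //; exact: measurable_tnth.
by apply/seteqP; split=> t /= h; [move=> i _|move=> i]; exact: h.
Qed.

Lemma tuple_measure_box_gt0 n (A : set T) : measurable A -> 0 < mu A ->
  0 < tuple_measure mu n [set t | forall i, A (tnth t i)].
Proof.
move=> mA A0; elim: n => [|n IH].
  by rewrite /= diracE mem_set ?lte01// => -[].
pose c (x : T * n.-tuple T) : n.+1.-tuple T := [tuple of x.1 :: x.2].
rewrite [ltRHS](_ : _ = (mu \x tuple_measure mu n)
    (A `*` [set t | forall i, A (tnth t i)])).
  by rewrite product_measure1E ?mule_gt0//; exact: measurable_tuple_box.
transitivity ((mu \x tuple_measure mu n) (c @^-1` [set t | forall i, A (tnth t i)])) => //.
congr (_ _); apply/seteqP; split=> -[x t] /= h.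
  split; first by have := h ord0; rewrite tnth0.
  by move=> i; have := h (lift ord0 i); rewrite tnthS.
case: h => Ax At i; have [j ->|->] := unliftP ord0 i; last by rewrite tnth0.
by rewrite tnthS; exact: At.
Qed.

End tuples.

(** * The topology and the measure of complex space *)

Section l1norm.
Context {R : realType} {n : nat}.
Local Notation C := R[i].
Local Notation R2 := (measurableTypeR R * measurableTypeR R)%type.
Implicit Types (x y z w : 'rV[C]_n) (S : set 'rV[C]_n).

(** The topology of ['rV[C]_n] comes from a norm with values in [C]; this
    real-valued one is invariant under multiplication by unimodular scalars and
    adds up over the coordinates. *)
Definition l1norm x : R := \sum_(j < n) modulus (x 0 j).

Lemma l1norm_ge0 x : 0 <= l1norm x.
Proof. by apply: sumr_ge0 => j _; exact: modulus_ge0. Qed.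

Lemma l1norm0 : l1norm 0 = 0.
Proof. by rewrite /l1norm big1// => j _; rewrite mxE modulus0. Qed.

Lemma l1normN x : l1norm (- x) = l1norm x.
Proof. by apply: eq_bigr => j _; rewrite mxE modulusN. Qed.

Lemma le_l1normD x y : l1norm (x + y) <= l1norm x + l1norm y.
Proof. by rewrite -big_split; apply: ler_sum => j _; rewrite mxE le_modulusD. Qed.

Lemma l1normZ (c : C) x : l1norm (c *: x) = modulus c * l1norm x.
Proof. by rewrite /l1norm mulr_sumr; apply: eq_bigr => j _; rewrite mxE modulusM. Qed.

Lemma le_coord_l1norm x j : modulus (x 0 j) <= l1norm x.
Proof. by rewrite /l1norm (bigD1 j)//= lerDl sumr_ge0// => i _; exact: modulus_ge0. Qed.

Lemma nbhs_l1normP z (V : set 'rV[C]_n) : nbhs z V <->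
  exists2 e : R, 0 < e & forall y, l1norm (y - z) < e -> V y.
Proof.
split=> [/nbhs_ballP[r /= /gt0_complex[-> r0] H]|[e e0 H]].
  exists (complex.Re r) => // y yz; apply: H; split; [by rewrite ltcR|move=> i j]; rewrite ord1 /ball/=.
  rewrite normC_modulus ltcR -modulusN opprB (le_lt_trans _ yz)//.
  by have := le_coord_l1norm (y - z) j; rewrite !mxE.
have n0 : 0 < n.+1%:R :> R by rewrite ltr0n.
apply/nbhs_ballP; exists (e / n.+1%:R)%:C%C; first by rewrite /= ltcR divr_gt0.
move=> y zy; apply: H.
apply: (@le_lt_trans _ _ (\sum_(j < n) e / n.+1%:R)).
  apply: ler_sum => j _; have [_ /(_ 0 j)] := zy.
  by rewrite /ball/= normC_modulus ltcR !mxE -modulusN opprB => /ltW.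
rewrite sumr_const card_ord -mulrnAr -[_ *+ n]mulr_natr gtr_pMr//.
by rewrite mulrC ltr_pdivrMr// mul1r ltr_nat.
Qed.

Definition l1open S := forall x, S x ->
  exists2 e : R, 0 < e & forall y, l1norm (y - x) < e -> S y.

(** Every open set is a countable union of boxes with rational data. *)
Lemma measurable_l1open S : l1open S -> measurable (@Cn_of_tuple R n @^-1` S).
Proof.
move=> oS.
pose box (q : n.-tuple (rat * rat) * nat) := [set t : n.-tuple R2 | forall i,
  ball (ratr (tnth q.1 i).1 : R) q.2.+1%:R^-1 (tnth t i).1 /\
  ball (ratr (tnth q.1 i).2 : R) q.2.+1%:R^-1 (tnth t i).2].
have mbox q : measurable (box q).
  rewrite (_ : box q = \bigcap_(i in [set: 'I_n]) ((@tnth n R2 ^~ i) @^-1`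
    ((ball (ratr (tnth q.1 i).1 : R) q.2.+1%:R^-1) `*`
     (ball (ratr (tnth q.1 i).2 : R) q.2.+1%:R^-1)))).
    apply: fin_bigcap_measurable => // i _.
    apply: measurable_preimage; first exact: measurable_tnth.
    by apply: measurableX; exact: measurable_ball.
  by apply/seteqP; split=> t h; [move=> i _|move=> i]; exact: h.
pose F (k : nat) := if unpickle k is Some q then
  if `[< box q `<=` @Cn_of_tuple R n @^-1` S >] then box q else set0 else set0.
rewrite (_ : _ @^-1` _ = \bigcup_k F k).
  apply: bigcupT_measurable => k; rewrite /F; case: unpickle => // q.
  by case: ifP.
apply/seteqP; split=> t /=; last first.
  move=> [k _]; rewrite /F; case: unpickle => // q.
  by case: ifPn => // /asboolP; exact.
move=> /oS[e e0 He].
pose k := Num.bound (4 * n%:R / e).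
have k0 : 0 < k.+1%:R^-1 :> R by rewrite invr_gt0.
have ke : 4 * n%:R * k.+1%:R^-1 < e.
  have h : 0 <= 4 * n%:R / e by rewrite divr_ge0 ?mulr_ge0 ?(ltW e0).
  have := archi_boundP h; rewrite -/k ltr_pdivrMr// => hk.
  by rewrite ltr_pdivrMr// (lt_trans hk)// mulrC ltr_pM2l// ltr_nat.
have rat_near (x : R) : exists q : rat, ball (ratr q : R) k.+1%:R^-1 x.
  have : x - k.+1%:R^-1 < x + k.+1%:R^-1 by rewrite ltrBlDr -addrA ltrDl addr_gt0.
  move=> /rat_in_itvoo[q]; rewrite in_itv/= => /andP[q1 q2].
  by exists q; rewrite /ball/= distrC ltr_distlC q1 q2.
pose r (x : R) := sval (cid (rat_near x)).
have rP (x : R) : ball (ratr (r x) : R) k.+1%:R^-1 x := svalP (cid (rat_near x)).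
pose q : n.-tuple (rat * rat) * nat := ([tuple (r (tnth t i).1, r (tnth t i).2) | i < n], k).
have bt : box q t by move=> i; rewrite tnth_mktuple; split; exact: rP.
exists (pickle q) => //; rewrite /F pickleK ifT//; apply/asboolP => t' bt'.
apply: He; apply: le_lt_trans ke.
have -> : 4 * n%:R * k.+1%:R^-1 = \sum_(j < n) 4 * k.+1%:R^-1 :> R.
  by rewrite sumr_const card_ord -[RHS]mulr_natr; ring.
apply: ler_sum => j _; apply: le_trans (le_modulus _) _.
rewrite !mxE; have [] := bt j; have [] := bt' j; rewrite /ball/=.
move: (ratr _) (ratr _) (tnth t j) (tnth t' j) k.+1%:R^-1 => a b [x y] [x' y'] l /=.
rewrite !ltr_norml => /andP[h1 h2] /andP[h3 h4] /andP[h5 h6] /andP[h7 h8].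
have A : `|x' + - x| <= 2 * l by rewrite ler_norml; move: h1 h2 h5 h6; clear; lra.
have B : `|y' + - y| <= 2 * l by rewrite ler_norml; move: h3 h4 h7 h8; clear; lra.
by move: A B; clear; lra.
Qed.

(** Coordinate by coordinate, the map is a planar rotation followed by a
    translation. *)
Lemma integral_Cn_affine (H : 'rV[C]_n -> \bar R) z (a : C) : modulus a = 1 ->
  measurable_fun setT (H \o @Cn_of_tuple R n) -> (forall x, 0 <= H x)%E ->
  (\int[tuple_measure lebesgue_measure2 n]_t H (z + a *: Cn_of_tuple t)%R =
   \int[tuple_measure lebesgue_measure2 n]_t H (Cn_of_tuple t))%E.
Proof.
move=> a1 mH H0.
pose f (i : 'I_n) (x : R2) : R2 :=
  let y := rotation (complex.Re a) (complex.Im a) x in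
  (y.1 + complex.Re (z 0 i), y.2 + complex.Im (z 0 i)).
have fp i : measure_preserving (@lebesgue_measure2 R) (f i).
  have a2 : complex.Re a ^+ 2 + complex.Im a ^+ 2 = 1.
    move: a1; case: a {f} => p q /=; rewrite /modulus/= => pq.
    by rewrite -(sqr_sqrtr (addr_ge0 (sqr_ge0 p) (sqr_ge0 q))) pq expr1n.
  exact: (measure_preserving_comp (lebesgue_measure2_rotation a2)
    (lebesgue_measure2_translate (complex.Re (z 0 i)) (complex.Im (z 0 i)))).
rewrite -[RHS](measure_preserving_integral (measure_preserving_tuple fp) mH); last first.
  by move=> t; exact: H0.
apply: eq_integral => t _ /=; congr H; apply/rowP => i; rewrite !mxE tnth_mktuple.
rewrite /f /rotation; case: (tnth t i) => x y; case: (z 0 i) => p q; case: (a) => u v /=.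
by apply/eqP; rewrite eq_complex /= [p + _]addrC [q + _]addrC [u * y + _]addrC !eqxx.
Qed.

End l1norm.

(** * Integrals over thin tubes around circles *)

Section thin_tube.
Context {R : realType} {n : nat}.
Local Notation C := R[i].
Local Notation R2 := (measurableTypeR R * measurableTypeR R)%type.
Local Notation mun := (tuple_measure (@lebesgue_measure2 R) n).
Local Notation Cn := (@Cn_of_tuple R n).
Implicit Types (x y z w : 'rV[C]_n) (S D : set 'rV[C]_n).

(** Monotonicity of the integral for an arbitrary majorant: the integral of a
    nonnegative function is a supremum over the simple functions below it. *)
Lemma ge0_le_integral_nonmeasurable d (T : measurableType d)
    (mu : {measure set T -> \bar R}) (f g : T -> \bar R) :
  (forall t, 0 <= f t)%E -> (forall t, f t <= g t)%E ->
  (\int[mu]_t f t <= \int[mu]_t g t)%E.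
Proof.
move=> f0 fg; have g0 t : (0 <= g t)%E by exact: le_trans (fg t).
rewrite !ge0_integralTE//; apply: ge_ereal_sup => _ [h /= hf <-].
by apply: ereal_sup_ubound; exists h => // t; exact: le_trans (hf t) (fg t).
Qed.

Definition l1continuous_on S (f : 'rV[C]_n -> R) := forall x, S x ->
  forall e : R, 0 < e -> exists2 d : R, 0 < d &
    forall y, l1norm (y - x) < d -> `|f y - f x| <= e.

(** The superlevel sets are open, hence measurable. *)
Lemma measurable_l1continuous S (f : 'rV[C]_n -> R) : l1open S ->
  l1continuous_on S f -> (forall x, 0 <= f x) ->
  measurable_fun setT ((fun x => if x \in S then f x else 0) \o Cn).
Proof.
move=> oS cf f0.
apply: (measurability _ (RGenOInfty.measurableE R)) => //.
move=> /= _ [_ [a ->] <-]; rewrite setTI.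
have [a0|a0] := leP 0 a; last first.
  rewrite (_ : _ @^-1` _ = setT)//; apply/seteqP; split=> // t _ /=.
  by rewrite in_itv/= andbT (lt_le_trans a0)//; case: ifP.
rewrite (_ : _ @^-1` _ = Cn @^-1` [set x | S x /\ a < f x]).
  apply: measurable_l1open => x [Sx fx].
  have [e e0 He] := oS x Sx.
  have d0 : 0 < (f x - a) / 2 by rewrite divr_gt0// subr_gt0.
  have [d d0' Hd] := cf x Sx _ d0.
  exists (Num.min e d); first by rewrite lt_min e0.
  move=> y; rewrite lt_min => /andP[/He Sy /Hd]; rewrite ler_distl => /andP[fy _].
  by split=> //; move: fx fy; clear; lra.
apply/seteqP; split=> t /=; rewrite in_itv/= andbT.
  by case: ifPn => [/set_mem|_]//; rewrite ltNge a0.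
by move=> [St ft]; rewrite mem_set.
Qed.

(** The half side is small enough for the cube to lie in the [l1norm] ball of
    radius [e]; [n.+1] avoids a division by zero. *)
Definition cube (e : R) : set (n.-tuple R2) :=
  [set t | forall i, (ball (0 : R) (e / (2 * n.+1%:R)) `*`
    ball (0 : R) (e / (2 * n.+1%:R))) (tnth t i)].

Lemma cube_l1norm (e : R) t : 0 < e -> cube e t -> l1norm (Cn t) < e.
Proof.
move=> e0 ct; set d := e / (2 * n.+1%:R) in ct.
have n0 : 0 < 2 * n.+1%:R :> R by rewrite mulr_gt0.
have d0 : 0 < d by rewrite divr_gt0.
apply: (@le_lt_trans _ _ (\sum_(j < n) 2 * d)).
  apply: ler_sum => j _; rewrite mxE; apply: le_trans (le_modulus _) _ => /=.
  have [] := ct j; rewrite /ball/= !sub0r !normrN -/d.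
  by move: (tnth t j) => [a b] /=; lra.
rewrite sumr_const card_ord -[_ *+ n]mulr_natr.
have -> : e = d * (2 * n.+1%:R) by rewrite divfK ?gt_eqF.
have : (n%:R : R) < n.+1%:R by rewrite ltr_nat.
by move: d0; clear; nra.
Qed.

Lemma measurable_cube (e : R) : measurable (cube e).
Proof.
by apply: measurable_tuple_box; apply: measurableX; exact: measurable_ball.
Qed.

Lemma cube_gt0 (e : R) : 0 < e -> (0 < mun (cube e))%E.
Proof.
move=> e0; have d0 : 0 < e / (2 * n.+1%:R) by rewrite divr_gt0// mulr_gt0.
apply: tuple_measure_box_gt0.
  by apply: measurableX; exact: measurable_ball.
rewrite /= /lebesgue_measure2 product_measure1E; try exact: measurable_ball.
have b0 : (0 < @lebesgue_measure R (ball (0 : R)%R (e / (2 * n.+1%:R))%R))%E.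
  by have /= -> := lebesgue_measure_ball (0 : R) (ltW d0); rewrite lte_fin mulrn_wgt0.
exact: mule_gt0.
Qed.

Definition circle z w t : 'rV[C]_n := z + expi 0 t *: w.

Lemma circle_period z w t : circle z w (t + 2 * pi) = circle z w t.
Proof. by rewrite /circle expi2pi. Qed.

Lemma circle_add z w y t : circle z (w + y) t - circle z w t = expi 0 t *: y.
Proof. by rewrite /circle scalerDr; apply/rowP => i; rewrite !mxE; ring. Qed.

Lemma l1norm_rotate t y : l1norm (expi 0 t *: y) = l1norm y.
Proof. by rewrite l1normZ expi_modulus expR0 mul1r. Qed.

Lemma circle_continuous z w t : forall e : R, 0 < e -> exists2 d : R, 0 < d &
  forall s, `|s - t| < d -> l1norm (circle z w s - circle z w t) <= e.
Proof.
move=> e e0; have k0 : 0 < l1norm w + 1 by rewrite ltr_wpDl// l1norm_ge0.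
have [d d0 H] := expi_continuous t (divr_gt0 e0 k0).
exists d => // s /H {}H.
have -> : circle z w s - circle z w t = (expi 0 s - expi 0 t) *: w.
  by rewrite /circle scalerBl; apply/rowP => i; rewrite !mxE; ring.
rewrite l1normZ (le_trans (ler_wpM2r (l1norm_ge0 w) H))//.
by rewrite mulrAC ler_pdivrMr// ler_pM2l// lerDl.
Qed.

Definition tube z w e := [set x | exists t, l1norm (x - circle z w t) < e].

Lemma l1open_tube z w e : l1open (tube z w e).
Proof.
move=> x [t xt]; exists (e - l1norm (x - circle z w t)); first by rewrite subr_gt0.
move=> y yx; exists t; rewrite -[y - _](subrKA x).
by rewrite (le_lt_trans (le_l1normD _ _))// -ltrBrDr.
Qed.

Lemma measurable_circle_map z w :
  measurable_fun setT (fun x : measurableTypeR R * n.-tuple R2 =>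
    [tuple (complex.Re (circle z (w + Cn x.2) x.1 0 i),
            complex.Im (circle z (w + Cn x.2) x.1 0 i)) | i < n]).
Proof.
apply/measurable_fun_tnthP => i.
rewrite (_ : _ \o _ = (fun x : measurableTypeR R * n.-tuple R2 =>
  (complex.Re (z 0 i) + (cos x.1 * (complex.Re (w 0 i) + (tnth x.2 i).1) -
                         sin x.1 * (complex.Im (w 0 i) + (tnth x.2 i).2)),
   complex.Im (z 0 i) + (cos x.1 * (complex.Im (w 0 i) + (tnth x.2 i).2) +
                         sin x.1 * (complex.Re (w 0 i) + (tnth x.2 i).1))))); last first.
  apply/funext => -[t y] /=; rewrite tnth_mktuple /circle /expi expR0 !mxE.
  case: (z 0 i) (w 0 i) (tnth y i) => a b [c d] [u v] /=.
  by congr (_, _); ring.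
have m1 : measurable_fun setT (fun x : measurableTypeR R * n.-tuple R2 => (tnth x.2 i).1).
  apply: (measurableT_comp measurable_fst).
  exact: (measurableT_comp (measurable_tnth i) measurable_snd).
have m2 : measurable_fun setT (fun x : measurableTypeR R * n.-tuple R2 => (tnth x.2 i).2).
  apply: (measurableT_comp measurable_snd).
  exact: (measurableT_comp (measurable_tnth i) measurable_snd).
have mc : measurable_fun setT (fun x : measurableTypeR R * n.-tuple R2 => cos x.1).
  apply: measurableT_comp; last exact: measurable_fst.
  by apply: continuous_measurable_fun; exact: continuous_cos.
have ms : measurable_fun setT (fun x : measurableTypeR R * n.-tuple R2 => sin x.1).
  apply: measurableT_comp; last exact: measurable_fst.
  by apply: continuous_measurable_fun; exact: continuous_sin.
apply/measurable_fun_pair.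
  apply: measurable_funD => //; apply: measurable_funB.
    by apply: measurable_funM => //; exact: measurable_funD.
  by apply: measurable_funM => //; exact: measurable_funD.
apply: measurable_funD => //; apply: measurable_funD.
  by apply: measurable_funM => //; exact: measurable_funD.
by apply: measurable_funM => //; exact: measurable_funD.
Qed.

End thin_tube.

Section thin_tube_estimate.
Context {R : realType} {n : nat}.
Local Notation C := R[i].
Local Notation R2 := (measurableTypeR R * measurableTypeR R)%type.
Local Notation mu := (@lebesgue_measure R).
Local Notation mun := (tuple_measure (@lebesgue_measure2 R) n).
Local Notation Cn := (@Cn_of_tuple R n).
Implicit Types (x y z w : 'rV[C]_n) (D : set 'rV[C]_n) (g : 'rV[C]_n -> C)
  (Psi : 'rV[C]_n -> R) (e p L : R).

Lemma differentiable_l1continuous g x : differentiable g x ->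
  forall e, 0 < e -> exists2 d : R, 0 < d &
  forall y, l1norm (y - x) < d -> modulus (g y - g x) <= e.
Proof.
move=> /differentiable_continuous/cvgrPdist_le cg e e0.
have e0' : 0 < e%:C%C :> C by rewrite ltcR.
have /nbhs_l1normP[d d0 H] := cg _ e0'.
by exists d => // y /H; rewrite normC_modulus lecR -modulusN opprB.
Qed.

Lemma weight_l1continuous S g Psi p : 0 < p -> l1continuous_on setT Psi ->
  (forall x, S x -> differentiable g x) ->
  l1continuous_on S (fun x => modulus (g x) `^ p * expR (- p * Psi x)).
Proof.
move=> p0 cPsi dg x Sx.
move=> e e0.
pose a0 := modulus (g x) `^ p; pose b0 := expR (- p * Psi x).
pose k : R := a0 + b0 + 1.
have a00 : 0 <= a0 by exact: powR_ge0.
have b00 : 0 < b0 by exact: expR_gt0.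
have k0 : 0 < k by rewrite /k; move: a00 b00; clear; lra.
pose d : R := Num.min 1 (e / k).
have d0 : 0 < d by rewrite lt_min ltr01 divr_gt0.
have d1 : d <= 1 by rewrite ge_min lexx.
have dk : d * k <= e by rewrite -ler_pdivlMr// ge_min lexx orbT.
have [h h0 H1] := powR_continuous_ge0 p0 (modulus_ge0 (g x)) d0.
have h20 : 0 < h / 2 by rewrite divr_gt0.
have [r r0 G] := differentiable_l1continuous (dg x Sx) h20.
have cexp : continuous (fun t : R => expR (- p * t)).
  move=> t; apply: (@continuous_comp _ _ _ (fun t => - p * t) expR).
    by apply: cvgM; [exact: cvg_cst|exact: cvg_id].
  exact: continuous_expR.
move/continuous_firstP : cexp => /(_ (Psi x) d d0)[l l0 H2].
have l20 : 0 < l / 2 by rewrite divr_gt0.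
have [q q0 H3] := cPsi x I _ l20.
exists (Num.min r q); first by rewrite lt_min r0.
move=> y; rewrite lt_min => /andP[/G yr /H3 yq].
have A : `|modulus (g y) `^ p - a0| <= d.
  apply: H1; first exact: modulus_ge0.
  apply: (@le_lt_trans _ _ (h / 2)); last by rewrite ltr_pdivrMr// ltr_pMr// ltr1n.
  rewrite ler_distl; have := le_modulusD (g y - g x) (g x); rewrite subrK.
  have N : modulus (g x - g y) = modulus (g y - g x) by rewrite -modulusN opprB.
  have := le_modulusD (g x - g y) (g y); rewrite subrK N.
  by move: yr; clear; lra.
have B : `|expR (- p * Psi y) - b0| <= d.
  apply: H2; apply: le_lt_trans yq _.
  by rewrite ltr_pdivrMr// ltr_pMr// ltr1n.
rewrite -/a0 -/b0; apply: le_trans dk.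
move: A B; set a := _ `^ p; set b := expR (- p * Psi y) => A B.
have -> : a * b - a0 * b0 = (a - a0) * (b - b0) + a0 * (b - b0) + (a - a0) * b0 by ring.
apply: le_trans (ler_normD _ _) _; apply: le_trans (lerD (ler_normD _ _) (lexx _)) _.
rewrite !normrM (ger0_norm a00) (gtr0_norm b00) /k.
have := ler_pM (normr_ge0 _) (normr_ge0 _) A B.
have := ler_wpM2l a00 B; have := ler_wpM2r (ltW b00) A.
have := ler_wpM2l (ltW d0) d1; clear; lra.
Qed.

Lemma le_fine (x : \bar R) : (0 <= x)%E -> ((fine x)%:E <= x)%E.
Proof. by case: x => [r||]//= _; rewrite leey. Qed.

Variables (z w : 'rV[C]_n) (g : 'rV[C]_n -> C) (Psi : 'rV[C]_n -> R).
Variables (e p L : R).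
Hypotheses (e0 : 0 < e) (p0 : 0 < p) (L0 : 0 <= L).
Hypothesis lipPsi : forall x y, `|Psi y - Psi x| <= L * l1norm (y - x).
Hypothesis dg : forall c y, modulus c <= 1 -> l1norm y < e ->
  differentiable g (z + c *: (w + y)).

Let lipschitz_l1continuous : l1continuous_on setT Psi.
Proof.
move=> x _ r r0; have k0 : 0 < L + 1 by rewrite ltr_wpDl.
exists (r / (L + 1)); first by rewrite divr_gt0.
move=> y; rewrite ltr_pdivlMr// => yx; apply: le_trans (lipPsi x y) _.
by apply: le_trans (ltW yx); rewrite mulrC ler_wpM2l ?l1norm_ge0// lerDl.
Qed.

Lemma lipschitz_circle_continuous v : continuous (Psi \o circle z v).
Proof.
apply/continuous_firstP => t r r0; have k0 : 0 < L + 1 by rewrite ltr_wpDl.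
have [d d0 H] := circle_continuous z v t (divr_gt0 r0 k0).
exists d => // s /H {}H; apply: le_trans (lipPsi _ _) _.
rewrite ler_pdivlMr// in H; apply: le_trans H.
by rewrite mulrC ler_wpM2l ?l1norm_ge0// lerDl.
Qed.

Definition circle_average : R := segint (Psi \o circle z w) 0 (2 * pi) / (2 * pi).

Let f x := modulus (g x) `^ p * expR (- p * Psi x).
Let S := tube z w e.
Let H x := if x \in S then f x else 0.
Let pi2 : 0 < 2 * pi :> R. Proof. by rewrite mulr_gt0// pi_gt0. Qed.

Let f_ge0 x : 0 <= f x. Proof. by rewrite mulr_ge0 ?powR_ge0 ?expR_ge0. Qed.

Let H_ge0 x : 0 <= H x. Proof. by rewrite /H; case: ifP. Qed.

Let dgS x : S x -> differentiable g x.
Proof.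
move=> [t xt]; set v := x - circle z w t in xt.
have u : expi 0 t * expi 0 (- t) = 1 :> C.
  by rewrite -expiD addr0 subrr /expi expR0 cos0 sin0 mul1r.
have -> : x = z + expi 0 t *: (w + expi 0 (- t) *: v).
  rewrite scalerDr scalerA u scale1r /v /circle.
  by apply/rowP => i; rewrite !mxE; ring.
by apply: dg; rewrite ?expi_modulus ?expR0// l1norm_rotate.
Qed.

Let mH : measurable_fun setT (H \o Cn).
Proof.
apply: measurable_l1continuous => //; first exact: l1open_tube.
exact: weight_l1continuous.
Qed.

Let A := modulus (g z) `^ p * expR (- p * (circle_average + L * e)).

Let A_le y : l1norm y < e ->
  A * (2 * pi) <= segint (H \o circle z (w + y)) 0 (2 * pi).
Proof.
move=> ye.
have HE : H \o circle z (w + y) = f \o circle z (w + y).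
  apply/funext => t /=; rewrite /H mem_set//; exists t.
  by rewrite circle_add l1norm_rotate.
have cpsi := @lipschitz_circle_continuous (w + y).
rewrite HE -ler_pdivlMr//.
have := @weighted_submean _ (fun c => g (z + c *: (w + y))) (Psi \o circle z (w + y)) p.
rewrite scale0r addr0 => W; apply: le_trans (W _ cpsi _ p0).
- rewrite /A ler_wpM2l ?powR_ge0// ler_expR !mulNr lerN2 ler_pM2l//.
  rewrite /circle_average ler_pdivrMr// [leRHS]mulrDl divfK ?gt_eqF//.
  have cw := @lipschitz_circle_continuous w.
  rewrite -lerBlDl -segintB//; try exact: continuous_subspaceT.
  rewrite -[X in _ <= _ * X]subr0; apply: segint_le; first exact: ltW.
    by apply: within_continuousB; exact: continuous_subspaceT.
  move=> t _ /=; apply: le_trans (ler_norm _) (le_trans (lipPsi _ _) _).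
  by rewrite circle_add l1norm_rotate ler_wpM2l// ltW.
- move=> c c1; have da : differentiable (fun c : C => z + c *: (w + y)) c.
    have d1 : differentiable (fun c : C => c *: (w + y)) c.
      by have [d1 _] := @is_diff_scalel _ 'rV[C]_n c (w + y); exact: d1.
    exact: (differentiableD (differentiable_cst z c) d1).
  exact: (differentiable_comp da (dg c1 ye)).
- by move=> t /=; rewrite circle_period.
Qed.

(** Averaging the one-variable inequality over the discs
    [c |-> z + c *: (w + y)], [y] in a small cube, replaces the circle mean by an
    integral over a subset of full dimension, at the cost of the constant
    factor [mun (cube e)]. *)
Lemma thin_tube_integral D (F : 'rV[C]_n -> \bar R) :
  tube z w e `<=` D -> (forall x, D x -> 0 <= F x)%E ->
  (forall x, tube z w e x ->
    (modulus (g x) `^ p * expR (- p * Psi x))%:E <= F x)%E ->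
  ((modulus (g z) `^ p * expR (- p * (circle_average + L * e)))%:E *
     mun (cube e) <= lebesgue_integral_Cn D F)%E.
Proof.
move=> SD F0 HF; rewrite -/A.
have A0 : 0 <= A by rewrite mulr_ge0 ?powR_ge0 ?expR_ge0.
pose HE x := (H x)%:E.
have HEF : (\int[mun]_t HE (Cn t) <= lebesgue_integral_Cn D F)%E.
  rewrite /lebesgue_integral_Cn [leRHS]integral_mkcond.
  apply: ge0_le_integral_nonmeasurable => t; first by rewrite lee_fin.
  rewrite /HE /H patchE; case: ifPn => [/set_mem St|_].
    by rewrite mem_set; [exact: HF|exact: SD].
  by case: ifPn => // /set_mem; exact: F0.
apply: le_trans HEF.
pose I : set (measurableTypeR R) := `[0, 2 * pi]%classic.
have muI : mu I = (2 * pi)%:E.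
  have /= -> := @lebesgue_measure_itv R `[0, 2 * pi].
  by rewrite lte_fin pi2 -EFinB subr0.
pose K (x : measurableTypeR R * n.-tuple R2) := HE (circle z (w + Cn x.2) x.1).
have mK : measurable_fun setT K.
  pose m := fun x : measurableTypeR R * n.-tuple R2 =>
    [tuple (complex.Re (circle z (w + Cn x.2) x.1 0 i),
            complex.Im (circle z (w + Cn x.2) x.1 0 i)) | i < n].
  rewrite (_ : K = EFin \o (H \o Cn) \o m).
    apply: measurableT_comp; last exact: measurable_circle_map.
    by apply: measurableT_comp.
  apply/funext => x; rewrite /K /HE /=; congr (H _)%:E; apply/rowP => i.
  by rewrite [RHS]mxE tnth_mktuple /=; case: (circle _ _ _ 0 i).
have K0 v : (0 <= K v)%E by rewrite lee_fin.
pose J (v : measurableTypeR R * n.-tuple R2) := ((\1_I v.1)%:E * K v)%E.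
have mJ : measurable_fun setT J.
  apply: emeasurable_funM => //.
  apply: measurableT_comp => //; apply: measurableT_comp; last exact: measurable_fst.
  by apply: measurable_indic; exact: measurable_itv.
have I0 t : (0 <= (\1_I t)%:E :> \bar R)%E by rewrite lee_fin indicE ler0n.
have J0 v : (0 <= J v)%E by apply: mule_ge0; [exact: I0|exact: K0].
have JI (s : n.-tuple R2) : (\int[mu]_(t in I) K (t, s) = \int[mu]_t J (t, s))%E.
  rewrite integral_mkcond; apply: eq_integral => t _.
  rewrite /J patchE indicE /=; case: ifP => _; first by rewrite mul1e.
  by rewrite mul0e.
have inner (s : n.-tuple R2) : cube e s -> (A%:E * (2 * pi)%:E <= \int[mu]_t J (t, s))%E.
  move=> cy; rewrite -JI -EFinM.
  have := A_le (cube_l1norm e0 cy); rewrite -lee_fin => /le_trans; apply.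
  rewrite /segint /Rintegral.
  rewrite [leRHS](_ : _ = \int[mu]_(t in I) (H (circle z (w + Cn s) t))%:E)%E//.
  by apply: le_fine; apply: integral_ge0 => t _; rewrite lee_fin; exact: H_ge0.
have outer : (A%:E * (2 * pi)%:E * mun (cube e) <=
    \int[mun]_s \int[mu]_t J (t, s))%E.
  have mG := measurable_fun_fubini_tonelli_G (m1 := mu) J mJ J0.
  apply: (@le_trans _ _ (\int[mun]_(s in cube e) \int[mu]_t J (t, s))%E).
    rewrite -integral_cst; last exact: measurable_cube.
    apply: ge0_le_integral => //; first exact: measurable_cube.
    - by move=> y _ /=; rewrite -EFinM lee_fin mulr_ge0// ltW.
    - exact: measurable_funTS.
  apply: ge0_subset_integral => //; first exact: measurable_cube.
  by move=> y _; exact: integral_ge0.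
have inv t : (\int[mun]_s K (t, s) = \int[mun]_s HE (Cn s))%E.
  have t1 : modulus (expi 0 t : C) = 1 by rewrite expi_modulus expR0.
  have mHE : measurable_fun setT (HE \o Cn) by apply: measurableT_comp.
  have HE0 x : (0 <= HE x)%E by rewrite lee_fin; exact: H_ge0.
  rewrite -(@integral_Cn_affine _ _ HE (circle z w t) _ t1 mHE HE0).
  by apply: eq_integral => s _; rewrite /K /circle scalerDr addrA.
have Jt t : (\int[mun]_s J (t, s) = (\1_I t)%:E * \int[mun]_s HE (Cn s))%E.
  have mKt : measurable_fun setT (fun s => K (t, s)).
    exact: (measurableT_comp mK (pair1_measurable t)).
  rewrite -(inv t).
  have := @ge0_integralZl _ _ _ mun setT measurableT (fun s => K (t, s)) mKt _ _ (I0 t).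
  by apply => s _; exact: K0.
set X := (\int[mun]_s HE (Cn s))%E in Jt *.
have X0 : (0 <= X)%E by apply: integral_ge0 => s _; rewrite lee_fin; exact: H_ge0.
have E : (\int[mun]_s \int[mu]_t J (t, s) = \int[mu]_t ((\1_I t)%:E * X))%E.
  rewrite -(fubini_tonelli J mJ J0); apply: eq_integral => t _; exact: Jt.
rewrite E in outer.
have mI : measurable I by exact: measurable_itv.
have EI : (\int[mu]_t ((\1_I t)%:E * X) = (2 * pi)%:E * X)%E.
  have mI1 : measurable_fun setT (fun t => (\1_I t)%:E : \bar R).
    by apply: measurableT_comp => //; exact: measurable_indic.
  rewrite (@ge0_integralZr _ _ _ mu setT measurableT _ mI1 X (fun t _ => I0 t) X0).
  by rewrite integral_indic// setIT; congr (_ * _)%E; exact: muI.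
rewrite EI in outer.
have pi2' : (0 < (2 * pi)%:E :> \bar R)%E by rewrite lte_fin.
rewrite -(@lee_pmul2l _ (2 * pi)%:E)//.
by rewrite muleA [((2 * pi)%:E * _)%E]muleC.
Qed.

End thin_tube_estimate.

(** * Tensors, dual norms and pairings *)

Lemma near_eq_differentiable (K : numFieldType) (V W : normedModType K)
    (f g : V -> W) (x : V) :
  (\forall y \near x, f y = g y) -> differentiable g x -> differentiable f x.
Proof.
move=> fg dg; have fgx : f x = g x := nbhs_singleton fg.
have fo : f \o shift x = cst (f x) + 'd g x +o_ 0 id.
  have /diff_locallyP[_] := dg.
  move=> /eqaddoE/eqaddoP go; apply/eqaddoP => eps eps0.
  have := go eps eps0; have fg0 : \forall y \near 0, f (y + x) = g (y + x).
    by move: fg; rewrite (near_shift 0) /= subr0.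
  by move: fg0; apply: filterS2 => y /= fgy; rewrite /= !fctE /= fgy fgx.
apply/diff_locallyP; have dgc : continuous ('d g x) by exact: diff_continuous.
by rewrite (diff_unique dgc fo).
Qed.

Section multilinear.
Context {R : realType} (m : nat) (W : lmodType R[i]).
Variable xi : ('I_m -> W) -> R[i].
Hypothesis mxi : multilinear_map xi.
Implicit Types (i : 'I_m) (u : 'I_m -> W).

Lemma multilinear0 i u : xi (dfwith u i 0) = 0.
Proof.
have := mxi i u 1 0 0; rewrite scaler0 addr0 mul1r => /eqP.
by rewrite -subr_eq subrr eq_sym => /eqP.
Qed.

Lemma multilinear_sum i u r (c : 'I_r -> R[i]) (b : 'I_r -> W) :
  xi (dfwith u i (\sum_k c k *: b k)) = \sum_k c k * xi (dfwith u i (b k)).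
Proof.
elim/big_rec2: _ => [|k y x _ <-]; first exact: multilinear0.
exact: mxi.
Qed.

Lemma multilinearZ i u c w : xi (dfwith u i (c *: w)) = c * xi (dfwith u i w).
Proof. by rewrite -[c *: w]addr0 mxi multilinear0 addr0. Qed.

(** Interpolates between [u] and the constant [v], so that multilinearity is used
    in one slot at a time. *)
Definition mixed_slots (j : nat) (v : W) u : 'I_m -> W :=
  fun l => if (l < j)%N then v else u l.

Lemma mixed_slotsS i v u :
  mixed_slots i.+1 v u = dfwith (mixed_slots i v u) i v.
Proof.
apply/funext => l; have [->|li] := eqVneq l i.
  by rewrite dfwithin /mixed_slots ltnSn.
rewrite dfwithout 1?eq_sym// /mixed_slots ltnS leq_eqVlt.
by have -> : (nat_of_ord l == i) = false by exact/negbTE.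
Qed.

Lemma mixed_slots0 v u : mixed_slots 0 v u = u.
Proof. by apply/funext. Qed.

Lemma mixed_slots_full v u : mixed_slots m v u = fun=> v.
Proof. by apply/funext => l; rewrite /mixed_slots ltn_ord. Qed.

Lemma multilinear_homogeneous c v : xi (fun=> c *: v) = c ^+ m * xi (fun=> v).
Proof.
have H j : (j <= m)%N ->
    xi (mixed_slots j (c *: v) (fun=> v)) = c ^+ j * xi (fun=> v).
  elim: j => [_|j IH jm]; first by rewrite mixed_slots0 mul1r.
  rewrite exprS -mulrA -(IH (ltnW jm)).
  rewrite -[j]/(nat_of_ord (Ordinal jm)) mixed_slotsS multilinearZ.
  congr (_ * xi _); apply/funext => l; rewrite /mixed_slots.
  have [->|lj] := eqVneq l (Ordinal jm); first by rewrite dfwithin /= ltnn.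
  by rewrite dfwithout 1?eq_sym.
by rewrite -(H m (leqnn m)) mixed_slots_full.
Qed.

End multilinear.

Section dual_norms.
Context {R : realType} {V : vectType R[i]}.
Local Notation C := R[i].
Variable h : V -> \bar R.
Hypothesis h0 : h 0 = 0%E.
Implicit Types (f : 'Hom(V, C)) (b : R).

Lemma norm_of_ge0 v : (0 <= norm_of h v)%E.
Proof. exact: sqrte_ge0. Qed.

Lemma norm_of0 : norm_of h 0 = 0%E.
Proof. by rewrite /norm_of h0 sqrte0. Qed.

Lemma dual_norm_ge0 f : (0 <= dual_norm h f)%E.
Proof.
rewrite /dual_norm; case: ifP => // _; apply: ereal_sup_ubound.
by exists 0; [rewrite /= norm_of0|rewrite linear0 modulus0].
Qed.

Lemma dual_norm_le f b : 0 <= b ->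
  (forall v, (norm_of h v <= 1)%E -> modulus (f v) <= b) ->
  (dual_norm h f <= b%:E)%E.
Proof.
move=> b0 H; rewrite /dual_norm; case: ifP => // _; apply: ge_ereal_sup.
by move=> _ [v /= hv <-]; rewrite lee_fin; exact: H.
Qed.

Lemma dual_norm0 : dual_norm h 0 = 0%E.
Proof.
apply/eqP; rewrite eq_le dual_norm_ge0 andbT; apply: dual_norm_le => // v _.
by rewrite zero_lfunE modulus0.
Qed.

Lemma le_dual_normZ f c b : 0 <= b -> (dual_norm h f <= b%:E)%E ->
  (dual_norm h (c *: f) <= (modulus c * b)%:E)%E.
Proof.
move=> b0; rewrite {1}/dual_norm; case: ifPn => [hoo _|hfin H].
  by rewrite /dual_norm hoo lee_fin mulr_ge0// modulus_ge0.
apply: dual_norm_le; first by rewrite mulr_ge0// modulus_ge0.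
move=> v hv; rewrite scale_lfunE modulusM ler_wpM2l ?modulus_ge0// -lee_fin.
by apply: le_trans H; apply: ereal_sup_ubound; exists v.
Qed.

Lemma tensor_norm_ge0 m (xi : tensor m V) : (0 <= tensor_norm h xi)%E.
Proof.
rewrite /tensor_norm; case: ifP => // _.
apply: (@le_trans _ _ (modulus (xi (fun=> 0)))%:E); first by rewrite lee_fin modulus_ge0.
apply: ereal_sup_ubound; exists (fun=> 0) => // i /=.
by rewrite dual_norm0.
Qed.

(** The tensor is tested on [m] copies of [f / b], whose dual norm is at most 1.
    The case [f = 0] is apart: the tensor norm is a supremum only if some nonzero
    functional has finite norm. *)
Lemma le_tensor_norm m (xi : tensor m V) f b : (0 < m)%N -> 0 < b ->
  (dual_norm h f <= b%:E)%E ->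
  ((modulus (xi (fun=> f)) / b ^+ m)%:E <= tensor_norm h xi)%E.
Proof.
move=> m0 b0 hf; have mxi := @tensor_multilinear _ _ _ xi.
have [f0|f0] := eqVneq f 0.
  rewrite f0 -[X in fun=> X](scale0r 0) multilinear_homogeneous// expr0n.
  by rewrite eqn0Ngt m0 mul0r modulus0 mul0r tensor_norm_ge0.
rewrite /tensor_norm ifT; last first.
  by apply/asboolP; exists f => //; apply: le_lt_trans hf (ltry _).
apply: ereal_sup_ubound; exists (fun=> b^-1%:C%C *: f).
  move=> i /=; have := le_dual_normZ b^-1%:C%C (ltW b0) hf.
  by rewrite modulusR ger0_norm ?invr_ge0 ?(ltW b0)// mulVf ?gt_eqF.
rewrite multilinear_homogeneous// modulusM modulusX modulusR.
by rewrite ger0_norm ?invr_ge0 ?(ltW b0)// exprVn mulrC.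
Qed.

End dual_norms.

Section sections.
Context {R : realType} {n : nat} {D : set 'rV[R[i]]_n} {r : nat}.
Local Notation C := R[i].
Variable E : hol_bundle D r.

Lemma dual_frame_expansion (i : frame_index E) z (v : 'Hom(fiber E z, C)) :
  frame_dom i z ->
  v = \sum_k v (tnth (frame i z) k) *: linfun (coord (frame i z) k).
Proof.
move=> iz; apply/lfunP => a.
have b := frame_basis iz.
rewrite {1}(coord_basis b (memvf a)) linear_sum sum_lfunE; apply: eq_bigr => k _.
by rewrite linearZ/= scale_lfunE lfunE (tnth_nth 0); exact: mulrC.
Qed.

(** Holomorphy is known for the components of [f] in a frame only, so that [u]
    is put into the slots one at a time, expanded in the dual frame. *)
Lemma pairing_holomorphic (U : set 'rV[C]_n) u m
    (f : forall w, tensor m (fiber E w)) : (0 < m)%N -> open U -> U `<=` D ->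
  holomorphic_dual_section U u -> holomorphic_tensor_section f ->
  holomorphic_on U (fun w => f w (fun=> u w)).
Proof.
move=> m0 oU UD hu hf z Uz.
have [i _ iz] : (\bigcup_(i : frame_index E) frame_dom i) z by rewrite -frame_dom_cover; exact: UD.
have idom : nbhs z (frame_dom i).
  by apply: open_nbhs_nbhs; split=> //; exact: frame_dom_open.
pose e (k : 'I_m -> 'I_r) w l := linfun (coord (frame i w) (k l)).
have H j : (j <= m)%N -> forall k,
    differentiable (fun w => f w (mixed_slots j (u w) (e k w))) z.
  elim: j => [_ k|j IH jm k].
    under eq_fun do rewrite mixed_slots0.
    exact: hf.
  have {}IH := IH (ltnW jm); pose l := Ordinal jm.
  apply: (@near_eq_differentiable _ _ _ _ (fun w => \sum_(q < r)
     u w (tnth (frame i w) q) * f w (mixed_slots j (u w) (e (dfwith k l q) w)))).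
    apply: filterS idom => w iw.
    rewrite -[j.+1]/(nat_of_ord l).+1 mixed_slotsS {2}(dual_frame_expansion (u w) iw).
    rewrite multilinear_sum; last exact: tensor_multilinear.
    apply: eq_bigr => q _; congr (_ * f w _); apply/funext => l'.
    rewrite /mixed_slots /e; have [->|ll] := eqVneq l' l.
      by rewrite !dfwithin /= ltnn.
    by rewrite !dfwithout 1?eq_sym.
  pose F q w := u w (tnth (frame i w) q) * f w (mixed_slots j (u w) (e (dfwith k l q) w)).
  rewrite (_ : (fun w => _) = \sum_q F q); last by apply/funext => w; rewrite fct_sumE.
  apply: differentiable_sum => q.
  exact: (differentiableM (hu i q z (conj Uz iz)) (IH _)).
have full (k : 'I_m -> 'I_r) : differentiable (fun w => f w (fun=> u w)) z.
  by have := H m (leqnn m) k; under eq_fun do rewrite mixed_slots_full.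
have [r0|r0] := posnP r; last exact: (full (fun=> Ordinal r0)).
(* in rank 0 the pairing vanishes identically *)
apply: (@near_eq_differentiable _ _ _ _ (fun=> 0)); last exact: differentiable_cst.
apply: filterS idom => w iw.
rewrite (dual_frame_expansion (u w) iw) big1; last first.
  by move=> k; have := ltn_ord k; rewrite [X in (_ < X)%N]r0.
have mf := @tensor_multilinear _ _ _ (f w).
by rewrite -[X in fun=> X](scale0r 0) multilinear_homogeneous// expr0n eqn0Ngt m0 mul0r.
Qed.

End sections.

(** * The circle inequality for Lipschitz majorants *)

Section circle_inequality.
Context {R : realType}.
Local Notation C := R[i].

(** Taking logarithms and dividing by [m], the factors [c m] and [v] disappear
    in the limit. *)
Lemma exponential_rate (c : nat -> R) (p X B v : R) :
  (forall m, (0 < m)%N -> 0 < c m) ->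
  (fun m => m%:R^-1 * ln (c m)) @ \oo --> (0 : R) ->
  0 < p -> 0 <= X -> 0 < v ->
  (forall m, (0 < m)%N ->
    (X ^+ m) `^ p * expR (- p * (m%:R * B)) * v <= c m) ->
  X <= expR B.
Proof.
move=> c0 cv p0 X0 v0 H; rewrite leNgt; apply/negP => BX.
have X0' : 0 < X by apply: lt_trans BX; exact: expR_gt0.
have d0 : 0 < p * (ln X - B).
  by rewrite mulr_gt0// subr_gt0 -ltr_expR lnK.
set d := p * _ in d0.
have d20 : 0 < d / 2 by rewrite divr_gt0.
move/cvgrPdist_lt : cv => /(_ _ d20)[N _ HN].
pose M := Num.bound `|- ln v / (d / 2)|.
pose m := (maxn N M).+1.
have m0 : (0 < m)%N by [].
have m0' : 0 < m%:R :> R by rewrite ltr0n.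
have h1 : m%:R^-1 * ln (c m) < d / 2.
  have := HN m (leqW (leq_maxl _ _)); rewrite /= sub0r normrN.
  exact: le_lt_trans (ler_norm _).
have h2 : - ln v < m%:R * (d / 2).
  rewrite -ltr_pdivrMr//; apply: le_lt_trans (ler_norm _) _.
  apply: lt_le_trans (archi_boundP (normr_ge0 _)) _; rewrite ler_nat.
  by rewrite /m; apply: leqW; rewrite leq_max; apply/orP; right; rewrite /M.
have := H m m0; rewrite -ler_ln ?posrE ?mulr_gt0 ?powR_gt0 ?exprn_gt0 ?expR_gt0 ?c0//.
rewrite lnM ?posrE ?mulr_gt0 ?powR_gt0 ?exprn_gt0 ?expR_gt0//.
rewrite lnM ?posrE ?mulr_gt0 ?powR_gt0 ?exprn_gt0 ?expR_gt0//.
rewrite ln_powR lnXn// expRK -[ln X *+ m]mulr_natr => h3.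
rewrite [X in X < _]mulrC ltr_pdivrMr// in h1.
by move: h1 h2 h3; rewrite /d; move: (ln X) (ln v) (ln (c m)) (m%:R : R) => a b k q; clear; lra.
Qed.

Context {n : nat} {D : set 'rV[C]_n} {r : nat} (E : hol_bundle D r).
Variable h : forall z, fiber E z -> \bar R.
Arguments h : clear implicits.
Hypothesis hh : singular_finsler_metric h.

Lemma finsler0 z : D z -> h z 0 = 0%E.
Proof.
move=> Dz; have [_ /(_ 0)] := hh Dz 0.
by rewrite scaler0 modulus0 expr0n mul0e.
Qed.

(** Let [a] be a vector of norm at most 1 at [z], and [f] an extension of its
    [m]-th power. Then [g = <f, u ^ m>] satisfies [|g| <= |f| * exp (m * Psi)] on
    the tube, so that the estimate on thin tubes bounds [|u(a)|] by the average
    of [Psi], up to the [m]-th roots of [C_m] and of the volume of the cube. *)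
Lemma dual_norm_circle (p : R) (U : set 'rV[C]_n)
    (u : forall z, 'Hom(fiber E z, C)) (z w : 'rV[C]_n) (e L : R)
    (Psi : 'rV[C]_n -> R) :
  0 < p -> multiple_Lp_extension h p ->
  open U -> U `<=` D -> holomorphic_dual_section U u ->
  0 < e -> 0 <= L ->
  (forall x y, `|Psi y - Psi x| <= L * l1norm (y - x)) ->
  (forall (c : C) y, modulus c <= 1 -> l1norm y < e -> U (z + c *: (w + y))) ->
  (forall x, tube z w e x -> (dual_norm (h x) (u x) <= (expR (Psi x))%:E)%E) ->
  (dual_norm (h z) (u z) <= (expR (circle_average z w Psi))%:E)%E.
Proof.
move=> p0 [c [c0 cv ext]] oU UD hu e0 L0 lip disc tubeP.
have Uz : U z by have := disc 0 0; rewrite scale0r addr0 modulus0 l1norm0; exact.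
have Dz := UD _ Uz.
have tubeU x : tube z w e x -> U x.
  move=> [t xt]; set y := x - circle z w t in xt.
  have uu : expi 0 t * expi 0 (- t) = 1 :> C.
    by rewrite -expiD addr0 subrr /expi expR0 cos0 sin0 mul1r.
  have -> : x = z + expi 0 t *: (w + expi 0 (- t) *: y).
    rewrite scalerDr scalerA uu scale1r /y /circle.
    by apply/rowP => i; rewrite !mxE; ring.
  by apply: disc; rewrite ?expi_modulus ?expR0// l1norm_rotate.
suff main (e' : R) : 0 < e' -> e' <= e ->
    (dual_norm (h z) (u z) <= (expR (circle_average z w Psi + L * e'))%:E)%E.
  have [r0 rfin] : exists r0 : R, dual_norm (h z) (u z) = r0%:E.
    have := main e e0 (lexx _); have := dual_norm_ge0 (finsler0 Dz) (u z).
    by case: (dual_norm _ _) => // r0; exists r0.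
  rewrite rfin lee_fin; have [r00|r00] := leP r0 0.
    by rewrite (le_trans r00)// expR_ge0.
  rewrite -[leLHS]lnK ?posrE// ler_expR; apply/ler_addgt0Pr => d d0.
  have k0 : 0 < L + 1 by rewrite ltr_wpDl.
  pose e' := Num.min e (d / (L + 1)).
  have e'0 : 0 < e' by rewrite lt_min e0 divr_gt0.
  have e'e : e' <= e by rewrite ge_min lexx.
  have e'd : e' * (L + 1) <= d by rewrite -ler_pdivlMr// ge_min lexx orbT.
  have := main e' e'0 e'e; rewrite rfin lee_fin -[leLHS]lnK ?posrE// ler_expR.
  by move: e'd e'0; clear; move: e' (circle_average _ _ _) (ln _) => q a b; lra.
move=> e'0 e'e.
apply: dual_norm_le; first exact: expR_ge0.
move=> a a1.
have [->|a0] := eqVneq a 0; first by rewrite linear0 modulus0 expR_ge0.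
have vol := @cube_gt0 R n e' e'0.
set vol_e := tuple_measure _ _ _ in vol.
have [v v0 vv] : exists2 v : R, 0 < v & (v%:E <= vol_e)%E.
  move: vol; case: vol_e => [v| |]//= v0; first by exists v.
  by exists 1 => //; rewrite leey.
apply: (@exponential_rate c p _ _ v) => //; first exact: modulus_ge0.
move=> m m0.
have [f [hf fz intf]] := ext z a m Dz a0 (le_lt_trans a1 (ltry _)) m0.
pose g x := f x (fun=> u x).
have hg := pairing_holomorphic m0 oU UD hu hf.
have lip' x y : `|m%:R * Psi y - m%:R * Psi x| <= m%:R * L * l1norm (y - x).
  by rewrite -mulrBr normrM ger0_norm// -mulrA ler_wpM2l.
have tubee' x : tube z w e' x -> tube z w e x.
  by move=> [t xt]; exists t; exact: lt_le_trans xt e'e.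
have := @thin_tube_integral R n z w g (fun x => m%:R * Psi x) e' p (m%:R * L)
  e'0 p0 (mulr_ge0 (ler0n _ _) L0) lip' _ D
  (fun x => poweR (tensor_norm (h x) (f x)) p).
have bound x : tube z w e' x -> ((modulus (g x) `^ p *
    expR (- p * (m%:R * Psi x)))%:E <= poweR (tensor_norm (h x) (f x)) p)%E.
  move=> /tubee' xt; have Dx := UD _ (tubeU _ xt).
  have b0 := expR_gt0 (Psi x).
  have le := le_tensor_norm (finsler0 Dx) (f x) m0 b0 (tubeP x xt).
  have q0 : 0 <= modulus (g x) / expR (Psi x) ^+ m.
    by rewrite divr_ge0 ?modulus_ge0// exprn_ge0// ltW.
  apply: le_trans (gt0_ler_poweR (ltW p0) _ _ le).
  - rewrite lee_fin powRM ?modulus_ge0 ?invr_ge0 ?exprn_ge0 ?(ltW b0)//.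
    by rewrite -expRM_natl -expRN -expRM !mulNr [p * _]mulrC.
  - by rewrite in_itv/= leey andbT lee_fin.
  - by rewrite in_itv/= leey andbT (tensor_norm_ge0 (finsler0 Dx)).
move=> T; have {}T := le_trans (T _ _ _ bound) intf.
have dg c' y : modulus c' <= 1 -> l1norm y < e' -> differentiable g (z + c' *: (w + y)).
  by move=> c1 ye; apply: hg; apply: disc => //; exact: lt_le_trans ye e'e.
have tubeD : tube z w e' `<=` D by move=> x /tubee'/tubeU/UD.
have {}T := T dg tubeD (fun x _ => poweR_ge0 _ _).
have gz : modulus (g z) = modulus (u z a) ^+ m.
  by rewrite /g fz /= prodr_const card_ord modulusX.
have cPsi : continuous (Psi \o circle z w).
  exact: (lipschitz_circle_continuous L0 lip).
have avg : circle_average z w (fun x => m%:R * Psi x) = m%:R * circle_average z w Psi.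
  rewrite /circle_average mulrA; congr (_ / _).
  by apply: segintZ; exact: continuous_subspaceT.
have a_le1 : (poweR (norm_of (h z) a) (m%:R * p) <= 1)%E.
  have mp : 0 <= m%:R * p by rewrite mulr_ge0// ltW.
  rewrite -(poweR1r (m%:R * p)); apply: gt0_ler_poweR => //.
    by rewrite in_itv/= norm_of_ge0 leey.
  by rewrite in_itv/= lee01 leey.
rewrite -lee_fin EFinM; apply: le_trans (_ : (c m)%:E * 1 <= _)%E; last by rewrite mule1.
have cm0 : (0 <= (c m)%:E)%E by rewrite lee_fin ltW// c0.
apply: le_trans (lee_wpmul2l cm0 a_le1); apply: le_trans T.
rewrite gz avg -mulrA -mulrDr.
by apply: lee_wpmul2l => //; rewrite lee_fin mulr_ge0 ?powR_ge0 ?expR_ge0.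
Qed.

End circle_inequality.

(** * From Lipschitz to semicontinuous functions *)

Section circle_mean.
Context {R : realType} {n : nat}.
Local Notation C := R[i].
Local Notation mu := (@lebesgue_measure R).
Implicit Types (x y z w : 'rV[C]_n) (U : set 'rV[C]_n).

(** Compactness of the disc, seen inside the square [[-1, 1]^2]. *)
Lemma disc_uniform_scale (Q : R -> 'rV[C]_n -> Prop) z w :
  (forall d d' y, d' <= d -> Q d y -> Q d' y) ->
  (forall c : C, modulus c <= 1 -> exists2 e : R, 0 < e &
     forall y, l1norm (y - (z + c *: w)) < e -> Q e y) ->
  exists2 d : R, 0 < d & forall (c : C) y, modulus c <= 1 ->
     l1norm (y - (z + c *: w)) < d -> Q d y.
Proof.
move=> Qmon H.
pose P (d : R) (x : R * R) := modulus (x.1 +i* x.2)%C <= 1 ->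
  forall y, l1norm (y - (z + (x.1 +i* x.2)%C *: w)) < d -> Q d y.
pose K : set (R * R) := `[(-1) : R, 1]%classic `*` `[(-1) : R, 1]%classic.
have cK : compact K by apply: compact_setX; exact: segment_compact.
have dist2 (a b a' b' h : R) : `|a - a'| < h -> `|b - b'| < h ->
    modulus ((a' +i* b')%C - (a +i* b)%C) < 2 * h.
  move=> aa bb; apply: le_lt_trans (le_modulus _) _; rewrite /= (distrC a') (distrC b').
  by move: aa bb; clear; lra.
have : \forall d \near 0^'+, K `<=` P d.
  apply: (compact_near_coveringP _).1 => //= -[a b] _.
  have [ab1|ab1] := leP (modulus (a +i* b)%C) 1; last first.
    pose h := (modulus (a +i* b)%C - 1) / 2.
    have h0 : 0 < h by rewrite divr_gt0// subr_gt0.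
    exists (ball ((a, b) : R * R) h, [set d : R | 0 < d]).
      split=> /=; first exact: nbhsx_ballx.
      exact: nbhs_right_gt.
    move=> [[a' b'] d] [/= [aa bb] _]; rewrite /P => ab'.
    have {}ab' : modulus (a' +i* b')%C <= 1 := ab'.
    exfalso; have := dist2 a b a' b' h aa bb; rewrite /h.
    have := le_modulusB (a' +i* b')%C ((a' +i* b')%C - (a +i* b)%C).
    by rewrite subKr; move: ab'; clear; lra.
  have [e e0 He] := H _ ab1.
  have w0 : 0 < 1 + l1norm w by rewrite ltr_pwDl// l1norm_ge0.
  pose h := e / 4 / (1 + l1norm w).
  have h0 : 0 < h by rewrite !divr_gt0.
  have hw : h * (1 + l1norm w) = e / 4 by rewrite divfK ?gt_eqF.
  exists (ball ((a, b) : R * R) h, [set d : R | 0 < d < e / 2]).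
    split=> /=; first exact: nbhsx_ballx.
    near=> d; apply/andP; split; near: d; first exact: nbhs_right_gt.
    by apply: nbhs_right_lt; rewrite divr_gt0.
  move=> [[a' b'] d] [/= [aa bb] /andP[d0 de]]; rewrite /P => ab' y yd.
  apply: (Qmon e); first by move: de e0; clear; lra.
  apply: He; have := dist2 a b a' b' h aa bb.
  set c := (a +i* b)%C; set c' := (a' +i* b')%C => cc.
  have -> : y - (z + c *: w) = (y - (z + c' *: w)) + (c' - c) *: w.
    by rewrite scalerBl; apply/rowP => i; rewrite !mxE; ring.
  apply: le_lt_trans (le_l1normD _ _) _; rewrite l1normZ.
  have := ler_wpM2r (l1norm_ge0 w) (ltW cc).
  by have := l1norm_ge0 w; move: yd de hw h0; rewrite -/c'; clear; nra.
move=> /nbhs_ballP[r /= r0 {}H]; exists (r / 2); first by rewrite divr_gt0.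
move=> c y c1 yd.
have Kc : K (complex.Re c, complex.Im c).
  split=> /=; rewrite in_itv/= -ler_norml; apply: le_trans c1.
    exact: le_Re_modulus.
  exact: le_Im_modulus.
have r2 : ball (0 : R) r (r / 2).
  by rewrite /ball/= sub0r normrN gtr0_norm ?divr_gt0// gtr_pMr// invf_lt1// ltr1n.
have := H (r / 2) r2; rewrite divr_gt0// => /(_ isT _ Kc); rewrite /P/=.
by case: c c1 yd {Kc} => a b c1 yd /(_ c1 y yd).
Unshelve. all: by end_near. Qed.

Lemma circle_expi phi z w :
  (circle_mean phi z w = (2 * pi)^-1%:E *
    \int[lebesgue_measure]_(t in `[0%R, (2 * pi)%R]) phi (circle z w t))%E.
Proof.
rewrite /circle_mean.
suff -> : (fun t => phi (z + (cos t +i* sin t)%C *: w)) = phi \o circle z w by [].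
by apply/funext => t /=; rewrite /circle /expi expR0 mul1r.
Qed.

(** An upper semicontinuous function is the decreasing limit, on the tube, of
    the Lipschitz functions
    [x |-> sup over y of max (phi y) (- j) - j * l1norm (y - x)],
    so that the inequality passes from continuous majorants to [phi] itself by
    monotone convergence. *)
Section lipschitz_majorants.
Variables (phi : 'rV[C]_n -> \bar R) (U : set 'rV[C]_n) (z w : 'rV[C]_n).
Variables (d B : R).
Hypotheses (d0 : 0 < d) (B0 : 0 <= B).
Let S := tube z w d.
Hypothesis SU : S `<=` U.
Hypothesis phi_usc : usc_on U phi.
Hypothesis phiB : forall x, S x -> (phi x <= B%:E)%E.

Let trunc (j : nat) x : R := fine (maxe (phi x) (- j%:R)%:E).

Let truncP j x : S x -> (maxe (phi x) (- j%:R)%:E = (trunc j x)%:E)%E.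
Proof.
move=> Sx; rewrite /trunc fineK//; have := phiB Sx.
case: (phi x) => [r| |]//= _; first by rewrite -EFin_max.
by rewrite maxNye.
Qed.

Let le_trunc j x : S x -> (phi x <= (trunc j x)%:E)%E.
Proof. by move=> Sx; rewrite -truncP// le_max lexx. Qed.

Let trunc_le j x (a : R) : S x -> (phi x <= a%:E)%E -> - j%:R <= a -> trunc j x <= a.
Proof. by move=> Sx xa ja; rewrite -lee_fin -truncP// ge_max xa lee_fin. Qed.

Let trunc_anti i j x : (i <= j)%N -> S x -> trunc j x <= trunc i x.
Proof.
move=> ij Sx; rewrite -lee_fin -!truncP// ge_max !le_max lexx/= lee_fin lerN2.
by rewrite ler_nat ij orbT.
Qed.

Let truncB j x : S x -> trunc j x <= B.
Proof.
by move=> Sx; apply: trunc_le => //; [exact: phiB|rewrite (le_trans _ B0)// oppr_le0].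
Qed.

Definition majorant (j : nat) x : R :=
  sup [set trunc j y - j%:R * l1norm (y - x) | y in S].

Let S0 : S (circle z w 0).
Proof. by exists 0; rewrite subrr l1norm0. Qed.

Let has_sup_majorant j x : has_sup [set trunc j y - j%:R * l1norm (y - x) | y in S].
Proof.
split; first by eexists; exists (circle z w 0).
exists B => _ [y Sy <-]; rewrite lerBlDr (le_trans (truncB j Sy))// lerDl.
by rewrite mulr_ge0// l1norm_ge0.
Qed.

Let le_majorant j x y : S y -> trunc j y - j%:R * l1norm (y - x) <= majorant j x.
Proof. by move=> Sy; apply: ub_le_sup; [case: (has_sup_majorant j x)|exists y]. Qed.

Let majorant_le j x (a : R) :
  (forall y, S y -> trunc j y - j%:R * l1norm (y - x) <= a) -> majorant j x <= a.
Proof.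
move=> H; apply: ge_sup; first by case: (has_sup_majorant j x).
by move=> _ [y Sy <-]; exact: H.
Qed.

Lemma phi_le_majorant j x : S x -> (phi x <= (majorant j x)%:E)%E.
Proof.
move=> Sx; apply: le_trans (le_trunc j Sx) _; rewrite lee_fin.
by have := le_majorant j x Sx; rewrite subrr l1norm0 mulr0 subr0.
Qed.

Lemma majorantB j x : majorant j x <= B.
Proof.
apply: majorant_le => y Sy; rewrite lerBlDr (le_trans (truncB j Sy))// lerDl.
by rewrite mulr_ge0// l1norm_ge0.
Qed.

Lemma majorant_lipschitz j x y :
  `|majorant j y - majorant j x| <= j%:R * l1norm (y - x).
Proof.
have half a b : majorant j a <= majorant j b + j%:R * l1norm (a - b).
  apply: majorant_le => v Sv; rewrite lerBlDr.
  have := le_majorant j b Sv; rewrite lerBlDr => /le_trans; apply.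
  rewrite -addrA lerD2l -mulrDr ler_wpM2l// [leRHS]addrC.
  by rewrite -[v - b](subrKA a) le_l1normD.
rewrite ler_distl half andbT lerBlDr.
by rewrite -l1normN opprB half.
Qed.

Lemma majorant_anti i j x : (i <= j)%N -> majorant j x <= majorant i x.
Proof.
move=> ij; apply: majorant_le => y Sy; apply: le_trans (le_majorant i x Sy).
by rewrite lerB// ?trunc_anti// ler_wpM2r ?l1norm_ge0// ler_nat.
Qed.

Lemma majorant_lim x (a : R) : S x -> (phi x < a%:E)%E ->
  exists J, majorant J x <= a.
Proof.
move=> Sx xa; have [V xV HV] := phi_usc (SU Sx) xa.
have /nbhs_l1normP[e e0 He] := xV.
pose J := maxn (Num.bound `|a|) (Num.bound `|(B - a) / e|).
have Ja : - J%:R <= a.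
  rewrite lerNl (le_trans (ler_norm _))// normrN ltW//.
  by rewrite (lt_le_trans (archi_boundP (normr_ge0 _)))// ler_nat leq_maxl.
have Je : B - J%:R * e <= a.
  rewrite lerBlDr -lerBlDl -ler_pdivrMr// (le_trans (ler_norm _))// ltW//.
  by rewrite (lt_le_trans (archi_boundP (normr_ge0 _)))// ler_nat leq_maxr.
exists J; apply: majorant_le => y Sy; have [yx|yx] := ltP (l1norm (y - x)) e.
  rewrite lerBlDr; apply: (@le_trans _ _ a); last by rewrite lerDl mulr_ge0// l1norm_ge0.
  by apply: trunc_le => //; apply: ltW; apply: HV; [exact: He|exact: SU].
apply: le_trans Je; rewrite lerB ?truncB//.
by rewrite ler_wpM2l.
Qed.

Hypothesis ineq : forall (L : R) (Psi : 'rV[C]_n -> R), 0 <= L ->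
  (forall x y, `|Psi y - Psi x| <= L * l1norm (y - x)) ->
  (forall x, S x -> (phi x <= (Psi x)%:E)%E) ->
  (phi z <= (circle_average z w Psi)%:E)%E.

Lemma usc_circle_mean : (phi z <= circle_mean phi z w)%E.
Proof.
have S_circle t : S (circle z w t) by exists t; rewrite subrr l1norm0.
case phizE : (phi z) => [r| |]; last by rewrite leNye.
  2: by have := ineq (ler0n _ 0) (majorant_lipschitz 0) (@phi_le_majorant 0);
     rewrite phizE leye_eq.
have pi2 : 0 < 2 * pi :> R by rewrite mulr_gt0// pi_gt0.
pose I : set (measurableTypeR R) := `[0, 2 * pi]%classic.
have mI : measurable I by exact: measurable_itv.
have muI : mu I = (2 * pi)%:E.
  have /= -> := @lebesgue_measure_itv R `[0, 2 * pi].
  by rewrite lte_fin pi2 -EFinB subr0.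
pose g (j : nat) (t : R) : R := B - majorant j (circle z w t).
pose G (t : R) : \bar R := (B%:E - phi (circle z w t))%E.
have cm j : continuous (majorant j \o circle z w).
  exact: (lipschitz_circle_continuous (ler0n _ _) (majorant_lipschitz j)).
have cg j : continuous (g j).
  by move=> t; apply: cvgB; [exact: cvg_cst|exact: cm].
have mg j : measurable_fun I (EFin \o g j).
  apply: measurableT_comp => //; apply: measurable_funTS.
  exact: continuous_measurable_fun.
have g0 j t : I t -> (0 <= (EFin \o g j) t)%E.
  by move=> _; rewrite lee_fin subr_ge0 majorantB.
have ndg t : I t -> nondecreasing_seq (fun j => (EFin \o g j) t).
  by move=> _ i j ij; rewrite lee_fin lerB// majorant_anti.
have gG t : (EFin \o g j) t @[j --> \oo] --> G t.
  suff -> : G t = ereal_sup (range (fun j => (EFin \o g j) t)).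
    apply: ereal_nondecreasing_cvgn => i j ij.
    by rewrite lee_fin lerB// majorant_anti.
  apply/eqP; rewrite eq_le; apply/andP; split; last first.
    apply: ge_ereal_sup => _ [j _ <-]; rewrite /G /= EFinB.
    exact: leeB (lexx _) (phi_le_majorant j (S_circle t)).
  have key a : (phi (circle z w t) < a%:E)%E ->
      ((B - a)%:E <= ereal_sup (range (fun j => (EFin \o g j) t)))%E.
    move=> /(majorant_lim (S_circle t))[j ja].
    apply: le_trans (ereal_sup_ubound _); last by exists j.
    by rewrite lee_fin lerB.
  rewrite /G; have := phiB (S_circle t).
  case E : (phi _) => [s| |]//= _.
    rewrite -EFinB; apply/lee_addgt0Pr => e e0.
    have := key (s + e); rewrite E lte_fin ltrDl => /(_ e0).
    rewrite opprD addrA [leLHS]EFinB => h.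
    by rewrite -leeBlDr.
  rewrite leye_eq; apply/eqP/eqyP => A A0.
  by have := key (B - A); rewrite E ltNyr opprB addrC subrK => /(_ isT).
have intg j : (\int[mu]_(t in I) (EFin \o g j) t <= (2 * pi * (B - r))%:E)%E.
  have avg : r <= circle_average z w (majorant j).
    have := ineq (ler0n _ j) (majorant_lipschitz j) (@phi_le_majorant j).
    by rewrite phizE lee_fin.
  have ig : mu.-integrable I (EFin \o g j).
    by apply: integrable_itv; exact: continuous_subspaceT.
  rewrite -[leLHS]fineK; last exact: integrable_fin_num.
  rewrite -[fine _]/(segint (g j) 0 (2 * pi)) lee_fin.
  have cB : {within `[(0 : R), 2 * pi], continuous (fun=> B)}.
    by move=> ?; exact: cst_continuous.
  have cM : {within `[0, 2 * pi], continuous (majorant j \o circle z w)}.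
    exact: continuous_subspaceT (cm j).
  rewrite (segintB cB cM).
  rewrite segint_cst ?(ltW pi2)// subr0.
  move: avg; rewrite /circle_average ler_pdivlMr//.
  by rewrite -/(majorant j \o circle z w); move: (segint _ _ _) => q; rewrite mulrBr; lra.
have mG : measurable_fun I G.
  by apply: (emeasurable_fun_cvg (fun j => EFin \o g j)) => // t _; exact: gG.
have intG : (\int[mu]_(t in I) G t <= (2 * pi * (B - r))%:E)%E.
  have -> : (\int[mu]_(t in I) G t =
      \int[mu]_(t in I) limn (fun j => (EFin \o g j) t))%E.
    by apply: eq_integral => t _; apply/esym/cvg_lim => //; exact: gG.
  rewrite monotone_convergence//; apply: lime_le; last by apply: nearW => j; exact: intg.
  apply: ereal_nondecreasing_is_cvgn => i j ij.
  by apply: ge0_le_integral => // t It; [exact: g0|exact: ndg].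
have G0 t : I t -> (0 <= G t)%E.
  move=> _; rewrite /G; have := phiB (S_circle t).
  case: (phi _) => [s| |_]; [|by rewrite leye_eq|exact: leey].
  by rewrite -EFinB !lee_fin subr_ge0.
have iG : mu.-integrable I G.
  apply/integrableP; split; first exact: mG.
  apply: le_lt_trans (ltry (2 * pi * (B - r))); apply: le_trans intG.
  suff -> : (\int[mu]_(t in I) `|G t| = \int[mu]_(t in I) G t)%E by exact: lexx.
  by apply: eq_integral => t /set_mem It; rewrite gee0_abs//; exact: G0.
rewrite circle_expi.
have -> : (\int[lebesgue_measure]_(t in `[0%R, (2 * pi)%R]) phi (circle z w t) =
    (2 * pi * B)%:E - \int[mu]_(t in I) G t)%E.
  transitivity (\int[mu]_(t in I) (cst B%:E \- G) t)%E.
    apply: eq_integral => t _; rewrite /G /=.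
    have := phiB (S_circle t); case: (phi _) => [s| |]//= _.
    by congr _%:E; ring.
  rewrite integralB//; last first.
    by apply: integrable_itv => ?; exact: cst_continuous.
  rewrite integral_cst//; congr (_ - _)%E.
  by rewrite [X in (_ * X)%E]muI -EFinM mulrC.
move: intG; case: (\int[mu]_(t in I) G t)%E (integrable_fin_num mI iG) => // q _.
rewrite lee_fin -EFinB -EFinM lee_fin => qr.
rewrite mulrC ler_pdivlMr//.
by move: qr; rewrite mulrBr; lra.
Qed.

End lipschitz_majorants.

End circle_mean.

(** * Finiteness and plurisubharmonicity *)

Section dual_norm_finite.
Context {R : realType}.
Local Notation C := R[i].
Context {n : nat} {D : set 'rV[C]_n} {r : nat} (E : hol_bundle D r).
Variable h : forall z, fiber E z -> \bar R.
Arguments h : clear implicits.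
Hypothesis hh : singular_finsler_metric h.

Lemma lne_lt (x : \bar R) (a : R) : (lne x < a%:E)%E = (x < (expR a)%:E)%E.
Proof.
case: x => [x| |] //=; last by rewrite !ltNyr.
have [x0|x0] := leP x 0; first by rewrite ltNyr lte_fin (le_lt_trans x0)// expR_gt0.
by rewrite !lte_fin -ltr_expR lnK.
Qed.

Lemma lne_le (x : \bar R) (a : R) : (lne x <= a%:E)%E = (x <= (expR a)%:E)%E.
Proof.
case: x => [x| |] //=; last by rewrite !leNye.
have [x0|x0] := leP x 0; first by rewrite leNye lee_fin (le_trans x0)// expR_ge0.
by rewrite !lee_fin -ler_expR lnK.
Qed.

(** If [|u|] were infinite at [z], upper semicontinuity of the norm of
    [(x_j - z_j) u], which vanishes at [z], would still bound [|u|] by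
    [1 / |x_j - z_j|] near [z]; so [|u|] is bounded on a tube around a circle
    centred at [z], and hence at [z]. *)
Lemma dual_norm_lty (p : R) (U : set 'rV[C]_n)
    (u : forall z, 'Hom(fiber E z, C)) (z : 'rV[C]_n) :
  (0 < n)%N -> dual_norms_usc h -> 0 < p -> multiple_Lp_extension h p ->
  open U -> U `<=` D -> holomorphic_dual_section U u -> U z ->
  (dual_norm (h z) (u z) < +oo)%E.
Proof.
move=> n0 husc p0 ext oU UD hu Uz.
pose j : 'I_n := Ordinal n0.
pose v (x : 'rV[C]_n) := (x 0 j - z 0 j) *: u x.
have hv : holomorphic_dual_section U v.
  move=> i k x Ux.
  have dx : differentiable (fun x : 'rV[C]_n => x 0 j - z 0 j) x.
    exact: (differentiableB (@differentiable_coord _ _ _ x 0 j) (differentiable_cst _ _)).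
  have := differentiableM dx (hu i k x Ux).
  by rewrite (_ : _ * _ = fun x => v x (tnth (frame i x) k))//; apply/funext => y;
    rewrite /v scale_lfunE.
have vz : (dual_norm (h z) (v z) < 1%:E)%E.
  by rewrite /v subrr scale0r (dual_norm0 (finsler0 hh (UD _ Uz))) lte_fin.
have [V Vz HV] := husc U v oU UD hv z Uz 1 vz.
have /nbhs_l1normP[e e0 He] : nbhs z (V `&` U).
  by apply: filterI => //; exact: open_nbhs_nbhs.
have {HV} bound x : l1norm (x - z) < e -> U x /\ (dual_norm (h x) (v x) <= 1%:E)%E.
  by move=> /He[Vx Ux]; split=> //; apply: ltW; exact: HV.
pose d := e / 4.
have d0 : 0 < d by rewrite divr_gt0.
pose w : 'rV[C]_n := d%:C%C *: delta_mx 0 j.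
have wj : w 0 j = d%:C%C by rewrite !mxE !eqxx mulr1.
have wd : l1norm w = d.
  rewrite l1normZ modulusR gtr0_norm// /l1norm (bigD1 j)//= big1 ?addr0.
    by rewrite !mxE !eqxx [modulus _](ComplexField.Normc.normc1 R) mulr1.
  by move=> i /negbTE ij; rewrite !mxE ij andbF modulus0.
clearbody w.
have d20 : 0 < d / 2 by rewrite divr_gt0.
have dd : d / 2 < d by rewrite ltr_pdivrMr// ltr_pMr// ltr1n.
have de : d + d / 2 < e by rewrite /d; lra.
apply: le_lt_trans (ltry (expR (circle_average z w (fun=> ln (2 / d))))).
apply: (dual_norm_circle hh p0 ext oU UD hu d20 (lexx 0)).
- by move=> x y; rewrite subrr normr0 mul0r.
- move=> c y c1 y2; apply: (proj1 (bound _ _)).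
  have -> : z + c *: (w + y) - z = c *: (w + y) by rewrite addrC addKr.
  rewrite l1normZ; apply: le_lt_trans (ler_piMl (l1norm_ge0 _) c1) _.
  by apply: le_lt_trans (le_l1normD _ _) _; rewrite wd (le_lt_trans _ de)// lerD2l ltW.
move=> x [t xt].
have xz : l1norm (x - z) < e.
  have -> : x - z = (x - circle z w t) + expi 0 t *: w.
    by rewrite /circle opprD addrA subrK.
  apply: le_lt_trans (le_l1normD _ _) _; rewrite l1norm_rotate wd addrC.
  by rewrite (le_lt_trans _ de)// lerD2l ltW.
have [Ux vx] := bound x xz.
have dx : d / 2 <= modulus (x 0 j - z 0 j).
  have := le_coord_l1norm (x - circle z w t) j; rewrite /circle !mxE wj => h1.
  have := le_modulusB (x 0 j - z 0 j) (x 0 j - (z 0 j + expi 0 t * d%:C%C)).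
  have -> : x 0 j - z 0 j - (x 0 j - (z 0 j + expi 0 t * d%:C%C)) = expi 0 t * d%:C%C by ring.
  rewrite modulusM expi_modulus expR0 mul1r modulusR (gtr0_norm d0).
  by move: h1 xt; rewrite /circle; lra.
have xj0 : x 0 j - z 0 j != 0.
  by apply/eqP => x0; move: dx; rewrite x0 modulus0 leNgt d20.
have -> : u x = (x 0 j - z 0 j)^-1 *: v x by rewrite /v scalerA mulVf// scale1r.
apply: le_trans (le_dual_normZ _ ler01 vx) _.
rewrite lee_fin mulr1 modulusV lnK ?posrE ?divr_gt0//.
rewrite -[2 / d]invrK invf_div lef_pV2// posrE//.
exact: lt_le_trans d20 dx.
Qed.

End dual_norm_finite.

Theorem theorem1p2 (R : realType) (n : nat) (hn : (0 < n)%N)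
    (D : set 'rV[R[i]]_n) (hD : is_domain D) (hDb : bounded_set D)
    (r : nat) (E : hol_bundle D r)
    (h : forall z, fiber E z -> \bar R)
    (hh : singular_finsler_metric h)
    (husc : dual_norms_usc h)
    (p : R) (hp : 0 < p)
    (hext : multiple_Lp_extension h p) :
  griffiths_positive h.
Proof.
move=> U u oU UD hu.
pose phi z := lne (dual_norm (h z) (u z)).
have phi_lty z : U z -> (phi z < +oo)%E.
  move=> Uz; have := dual_norm_lty hh hn husc hp hext oU UD hu Uz.
  rewrite /phi; case: (dual_norm _ _) => [x _| |]//=.
  by case: ifP => // _; exact: ltry.
have phi_usc : usc_on U phi.
  move=> z Uz a; rewrite lne_lt => za.
  have [V Vz HV] := husc U u oU UD hu z Uz _ za.
  by exists V => // x Vx Ux; rewrite lne_lt; exact: HV.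
split=> // z w disc.
pose Q (d : R) x := 0 < d -> U x /\ (phi x <= (d^-1)%:E)%E.
have [d d0 Hd] : exists2 d : R, 0 < d & forall (c : R[i]) y, modulus c <= 1 ->
    l1norm (y - (z + c *: w)) < d -> Q d y.
  apply: disc_uniform_scale => [d d' y dd' Qd d'0|c c1].
    have d0 := lt_le_trans d'0 dd'; have [Uy yd] := Qd d0; split=> //.
    by apply: le_trans yd _; rewrite lee_fin lef_pV2.
  have Uc : U (z + c *: w) by apply: disc; rewrite normC_modulus lecR.
  have [b cb] : exists b : R, (phi (z + c *: w)%R < b%:E)%E.
    have := phi_lty _ Uc; case: (phi _) => [s _| |]//.
      by exists (s + 1); rewrite lte_fin ltrDl.
    by exists 0; rewrite ltNyr.
  have [V Vc HV] := phi_usc _ Uc b cb.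
  have /nbhs_l1normP[e e0 He] : nbhs (z + c *: w) (V `&` U).
    by apply: filterI => //; exact: open_nbhs_nbhs.
  have b0 : 0 < `|b| + 1 by rewrite ltr_wpDl.
  exists (Num.min e (`|b| + 1)^-1); first by rewrite lt_min e0 invr_gt0.
  move=> y; rewrite lt_min => /andP[/He[Vy Uy] _] m0; split=> //.
  apply: le_trans (ltW (HV y Vy Uy)) _; rewrite lee_fin.
  apply: (@le_trans _ _ (`|b| + 1)); first by rewrite (le_trans (ler_norm _))// lerDl.
  rewrite -[leLHS]invrK lef_pV2// ?posrE ?invr_gt0//.
  by rewrite ge_min lexx orbT.
have tubeQ x : tube z w d x -> U x /\ (phi x <= (d^-1)%:E)%E.
  by move=> [t xt]; apply: (Hd (expi 0 t) x) => //; rewrite expi_modulus expR0.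
apply: (@usc_circle_mean _ _ phi U z w d d^-1) => //.
- by rewrite invr_ge0 ltW.
- by move=> x /tubeQ[].
- by move=> x /tubeQ[].
move=> L Psi L0 lip phiPsi; rewrite lne_le.
apply: (dual_norm_circle hh hp hext oU UD hu d0 L0 lip).
  move=> c y c1 yd; apply: (proj1 (Hd c _ c1 _ d0)).
  have -> : z + c *: (w + y) - (z + c *: w) = c *: y.
    by rewrite scalerDr addrA [_ + c *: y]addrC addrK.
  by rewrite l1normZ (le_lt_trans _ yd)// ler_piMl// l1norm_ge0.
by move=> x xt; rewrite -lne_le; exact: phiPsi.
Qed.
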